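(* Holonomic Nilsson-Gevrey arithmetic series of order $0$ (that is, the holonomic elements of $\mathrm{NGA}\{0\}_0^{\mathbb{C}}$) are exactly the functions of the form $$\sum_{(\alpha,j,k)\in\mathbb{S}}\lambda_{\alpha,j,k}\,z^{\alpha}\log(z)^j f_{\alpha,j,k}(z)$$ where $\mathbb{S}$ is a finite subset of $\mathbb{Q}\times\mathbb{N}\times\mathbb{N}$, $\lambda_{\alpha,j,k}\in\mathbb{C}$, and each $f_{\alpha,j,k}(z)$ is a $G$-function.
   Context: An embedding of $\overline{\mathbb{Q}}$ into $\mathbb{C}$ is fixed. The determination of $\log(z)$ is arbitrary. For a power series $\sum_{n\ge0}a_nz^n\in\overline{\mathbb{Q}}[[z]]$ consider the arithmetic growth conditions, for some $C>0$: (a) $|\sigma(a_n)|\le C^{n+1}$ for every $\sigma\in\mathrm{Gal}(\overline{\mathbb{Q}}/\mathbb{Q})$ and every $n$; (b) there is a sequence of positive integers $d_n$ with $d_n\le C^{n+1}$ such that $d_na_m$ is an algebraic integer for all $m\le n$. A $G$-function is a power series in $\overline{\mathbb{Q}}[[z]]$ satisfying (a) and (b) which moreover satisfies a non-zero (homogeneous) linear differential equation with coefficients in $\overline{\mathbb{Q}}(z)$. A Nilsson-Gevrey arithmetic series of order $0$ (element of $\mathrm{NGA}\{0\}_0^{\mathbb{C}}$) is a function of the form $\sum_{(\alpha,j,k)\in\mathbb{S}}\lambda_{\alpha,j,k}\,z^{\alpha}\log(z)^j f_{\alpha,j,k}(z)$ where $\mathbb{S}\subset\mathbb{Q}\times\mathbb{N}\times\mathbb{N}$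 is finite, $\lambda_{\alpha,j,k}\in\mathbb{C}$, and each $f_{\alpha,j,k}(z)$ is a power series with coefficients in $\overline{\mathbb{Q}}$ satisfying (a) and (b), but not assumed to satisfy any differential equation. A function is holonomic if it is a solution of a non-zero homogeneous linear differential equation with coefficients in $\mathbb{C}(z)$. *)

(* Defs.v *)
From HB Require Import structures.
From mathcomp Require Import all_boot all_order all_algebra all_field.
From mathcomp Require Import fraction generic_quotient.
From mathcomp Require Import finmap.
From mathcomp Require Import complex.
From mathcomp Require Import all_classical all_reals all_analysis.

Set Implicit Arguments.
Unset Strict Implicit.
Unset Printing Implicit Defensive.

Import Order.TTheory GRing.Theory Num.Theory.
Import numFieldNormedType.Exports.

Local Open Scope classical_set_scope.
Local Open Scope ring_scope.
Local Open Scope complex_scope.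

(* The field of complex numbers is R[i] for R : realType.  The regular module
   R[i]^o is the same type, and it is the one that carries the topology and the
   norm; differentiation along 1 in it is complex differentiation. *)

Section ComplexFunctions.
Variable R : realType.
Local Notation C := (R[i]^o).

Definition cexp (z : C) : C :=
  (expR (complex.Re z))%:C * (cos (complex.Im z) +i* sin (complex.Im z)).

(* The plane cut along the closed half-line from 0 through u (0 is removed). *)
Definition slit_plane (u : C) : set C :=
  [set z | forall t : R, 0 <= t -> z <> t%:C * u].

Definition log_determination (u : C) (L : C -> C) : Prop :=
  {within slit_plane u, continuous L} /\
  (forall z, slit_plane u z -> cexp (L z) = z).

(* The coefficients of the rational function x are sent to C by phi.  The value
   depends on the fraction chosen to represent x only at the zeros of the
   denominator, which are finitely many; equations below are imposed near 0,
   away from 0. *)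
Definition ratfun_eval (K : fieldType) (phi : {rmorphism K -> R[i]})
    (x : {fraction {poly K}}) (z : C) : C :=
  (map_poly phi (frac (repr x)).1).[z] / (map_poly phi (frac (repr x)).2).[z].

(* F, as a germ at 0 of a function on the open set D, is a solution of a
   non-zero homogeneous linear differential equation with coefficients in K(z).
   Differentiability is required explicitly since derive1n is a total operator. *)
Definition linear_ode_solution (K : fieldType) (phi : {rmorphism K -> R[i]})
    (D : set C) (F : C -> C) : Prop :=
  exists (m : nat) (c : 'I_m.+1 -> {fraction {poly K}}),
    (exists i, c i != 0) /\
    \forall z \near within D (nbhs (0 : C)),
      (forall i : nat, (i < m)%N -> derivable (derive1n i F) z 1) /\
      \sum_(i < m.+1) ratfun_eval phi (c i) z * derive1n i F z = 0.

Definition holonomic (D : set C) (F : C -> C) : Prop :=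
  linear_ode_solution (idfun : {rmorphism R[i] -> R[i]}) D F.

End ComplexFunctions.

Section PowerSeries.
Variables (R : realType) (iota : {rmorphism algC -> R[i]}).
Local Notation C := (R[i]^o).

(* The elements of Gal(Qbar / Q) are the field automorphisms of algC. *)
Definition arith_growth (a : nat -> algC) : Prop :=
  exists2 B : R, 0 < B &
    (forall (sigma : {rmorphism algC -> algC}) (n : nat), bijective sigma ->
       `|iota (sigma (a n))| <= (B ^+ n.+1)%:C) /\
    (exists d : nat -> nat, forall n,
       [/\ (0 < d n)%N, (d n)%:R <= B ^+ n.+1 &
           forall m, (m <= n)%N -> (d n)%:R * a m \in Aint]).

Definition psum (a : nat -> algC) (z : C) : C :=
  limn (series (fun n => iota (a n) * z ^+ n : C)).

Definition Gfunction (a : nat -> algC) : Prop :=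
  arith_growth a /\ linear_ode_solution iota [set z | z <> 0] (psum a).

(* F agrees, near 0 in the plane cut along u, with a finite sum of terms
   lambda * z^alpha * (log z)^j * f(z), where log is the determination L, z^alpha
   is exp (alpha * log z), and all the power series f satisfy P. *)
Definition nilsson_form (P : (nat -> algC) -> Prop) (u : C) (L : C -> C)
    (F : C -> C) : Prop :=
  exists (S : {fset (rat * nat * nat)%type})
         (lambda : rat -> nat -> nat -> C)
         (f : rat -> nat -> nat -> nat -> algC),
    (forall alpha j k, (alpha, j, k) \in S -> P (f alpha j k)) /\
    \forall z \near within (slit_plane u) (nbhs (0 : C)),
      F z = \sum_(s <- S) let: (alpha, j, k) := s in
        lambda alpha j k * cexp (ratr alpha * L z) * L z ^+ j
          * psum (f alpha j k) z.

Definition NGA0 := nilsson_form arith_growth.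

End PowerSeries.

(* Main.v *)
Require Import Defs.
From mathcomp Require Import all_boot all_order all_algebra all_field.
From mathcomp Require Import fraction generic_quotient finmap complex.
From mathcomp Require Import all_classical all_reals all_analysis.
From mathcomp Require Import ring lra zify.
Set Implicit Arguments.
Unset Strict Implicit.
Unset Printing Implicit Defensive.
Import Order.TTheory GRing.Theory Num.Theory.
Import numFieldNormedType.Exports.
Local Open Scope classical_set_scope.
Local Open Scope ring_scope.
Local Open Scope complex_scope.

(** One direction is closure of holonomic functions under sums and products.  A
G-function, z^alpha and log z each satisfy a linear differential equation, so
every term of the sum lives in a finite system of first-order linear equations
with polynomial coefficients ([diffmod]), such systems can be added, and
any function expressed in one satisfies a scalar equation because its first n+1
derivatives have only n coordinates ([diffmod_ode]).

For the other direction, let F be a holonomic Nilsson series whose power series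
have arithmetic growth.  It can be written
  F = sum_(q, j, l) mu_l z^(q/N - M) (log z)^j h_(q,j,l)(z)
with the mu_l linearly independent over the algebraic numbers
([nilsson_normal_form]).  With theta = z d/dz, the equation of F becomes
sum_(i <= m) z^(m-i) p_i (z^i F^(i)) = 0, and the functions z^(q/N) (log z)^j are
linearly independent over convergent power series ([nilsson_indep]), so each
pair (q, j) contributes an identity between power series
  sum_l p_m mu_l theta^m h_(q,j,l) + terms in theta^k h_(q,j',l) with k < m = 0
whose coefficients are complex polynomials ([scalar_relation]).

The key point is the passage to algebraic coefficients.  A linear functional phi
from the complex to the algebraic numbers can be applied coefficient by
coefficient to such an identity.  Choose a point n0 where p_m does not vanish, and
functionals phi_t dual to the independent numbers p_m(n0) mu_l.  The resulting
identities have top-order coefficients phi_t(p_m mu_l), a square matrix that is the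
identity at n0, hence is invertible over the rational functions.  So all the
theta^m h_(q,j,l) are combinations of the theta^k h_(q,j',l') with k < m, with
algebraic rational functions as coefficients: these finitely many series form a
differential system over the algebraic numbers, and each h_(q,j,l) is a G-function
([descent_diffmod]). *)

(** * Complex differentiation *)

Section CTop.
Variable R : realType.
Local Notation C := (R[i]^o).
Local Notation normc := Normc.normc.

Lemma cnormE (z : R[i]) : `|z| = (normc z)%:C.
Proof. by rewrite normc_def; case: z. Qed.

Lemma normc_ge0 (z : R[i]) : 0 <= normc z.
Proof. by rewrite -ler0c -cnormE. Qed.

(** The order of R[i] is partial and its positive elements are real, so the
    radii of complex balls can be taken in R. *)
Lemma cpositiveE (e : R[i]) : 0 < e -> e = (complex.Re e)%:C /\ 0 < complex.Re e.
Proof. by case: e => a b; rewrite ltcE /= => /andP[/eqP -> ?]. Qed.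

Lemma nbhsCP (z : C) (P : set C) :
  nbhs z P <-> exists2 e : R, 0 < e & forall y, normc (y - z) < e -> P y.
Proof.
split.
  move=> /(nbhs_normP z P)[e /= e0 h]; have [eE er] := cpositiveE e0.
  exists (complex.Re e) => // y hy; apply: h => /=.
  by rewrite distrC cnormE eE ltcR.
case=> e e0 h; apply/(nbhs_normP z P); exists e%:C => /=; first by rewrite ltcR.
by move=> y /=; rewrite distrC cnormE ltcR; apply: h.
Qed.

Lemma cvgCP T (F : set_system T) {FF : Filter F} (f : T -> C) (l : C) :
  f @ F --> l <->
  forall e : R, 0 < e -> \forall x \near F, normc (f x - l) < e.
Proof.
split=> [h e e0|h A /nbhsCP[e e0 hA]].
  by apply: (h [set y | normc (y - l) < e]); apply/nbhsCP; exists e.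
by apply: filterS (h e e0) => x; apply: hA.
Qed.

(** Caratheodory's form of differentiability: once the difference quotient
    is replaced by a factorisation with a continuous factor, the chain rule and
    the derivative of a local inverse become compositions of continuous functions. *)
Lemma caratheodory (f : C -> C) (z df : C) :
  is_derive z (1 : C) f df <->
  exists phi : C -> C, [/\ phi z = df, phi y @[y --> z] --> phi z
    & forall y, f y - f z = phi y * (y - z)].
Proof.
split.
  case=> /cvg_ex[l hl] hd.
  have ld : l = df by rewrite -hd; apply/esym/cvg_lim.
  exists (fun y => if y == z then df else (f y - f z) / (y - z)); split.
  - by rewrite eqxx.
  - rewrite eqxx; apply/(cvgCP (F := nbhs z)) => e e0.
    move/(cvgCP (F := dnbhs (0:C))): hl => /(_ e e0).
    rewrite ld !nearE => /nbhsCP[d d0 hd']; apply/nbhsCP; exists d => // y hy.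
    case: eqP => [_|/eqP yz]; first by rewrite subrr Normc.normc0.
    have := hd' (y - z); rewrite subr0 => /(_ hy); rewrite subr_eq0 => /(_ yz) /=.
    by rewrite /= [_ *: 1]mulr1 subrK mulrC.
  - by move=> y; case: eqP => [->|/eqP yz]; rewrite ?subrr ?mulr0 // divfK ?subr_eq0.
case=> phi [hz hc hf].
have cv : (fun h => h^-1 *: ((f \o shift z) (h *: (1:C)) - f z)) @ (dnbhs (0:C)) --> df.
  apply/(cvgCP (F := dnbhs (0:C))) => e e0; move/(cvgCP (F := nbhs z)): hc => /(_ e e0).
  rewrite !nearE => /nbhsCP[d d0 hd']; apply/nbhsCP; exists d => // y hy y0.
  rewrite /= hf [_ *: 1]mulr1 addrK -hz.
  have -> : y^-1 *: (phi (y + z) * y) = phi (y + z).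
    by rewrite [LHS]mulrC mulfK.
  by apply: hd'; rewrite addrK -[y]subr0.
split; first by apply/cvg_ex; exists df.
exact/cvg_lim.
Qed.


Lemma cder_derivable (f : C -> C) z a : is_derive z (1 : C) f a -> derivable f z 1.
Proof. by case. Qed.

Lemma cder_val (f : C -> C) z a : is_derive z (1 : C) f a -> derive1 f z = a.
Proof. by case=> _ <-; rewrite derive1E. Qed.

Lemma derivable_cder (f : C -> C) z :
  derivable f z 1 -> is_derive z (1 : C) f (derive1 f z).
Proof. by move=> h; split; [exact: h | exact/esym/derive1E]. Qed.

Lemma cderD (f g : C -> C) z a b : is_derive z (1 : C) f a ->
  is_derive z (1 : C) g b -> is_derive z (1 : C) (fun y => f y + g y) (a + b).
Proof. exact: is_deriveD. Qed.

Lemma cderM (f g : C -> C) z a b : is_derive z (1 : C) f a ->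
  is_derive z (1 : C) g b ->
  is_derive z (1 : C) (fun y => f y * g y) (a * g z + f z * b).
Proof.
move=> hf hg; have := is_deriveM hf hg.
by rewrite addrC [g z *: a]mulrC.
Qed.

Lemma cder_cst (c z : C) : is_derive z (1 : C) (fun=> c) 0.
Proof. exact: is_derive_cst. Qed.

Lemma cder_id (z : C) : is_derive z (1 : C) id 1.
Proof. exact: is_derive_id. Qed.

Lemma cder_sum I (r : seq I) (f : I -> C -> C) (a : I -> C) z :
  (forall i, is_derive z (1 : C) (f i) (a i)) ->
  is_derive z (1 : C) (fun y => \sum_(i <- r) f i y) (\sum_(i <- r) a i).
Proof.
move=> h; elim: r => [|i r IH].
  rewrite big_nil (_ : (fun _ => _) = fun=> 0); first exact: cder_cst.
  by apply/funext => y; rewrite big_nil.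
rewrite big_cons (_ : (fun _ => _) = fun y => f i y + \sum_(i <- r) f i y).
  exact: cderD.
by apply/funext => y; rewrite big_cons.
Qed.

Lemma cder_continuous (f : C -> C) z a : is_derive z (1 : C) f a ->
  f y @[y --> z] --> f z.
Proof.
case=> h _; apply: differentiable_continuous; exact/derivable1_diffP.
Qed.

Lemma cder_comp (f g : C -> C) z a b : is_derive (g z) (1 : C) f a ->
  is_derive z (1 : C) g b -> is_derive z (1 : C) (fun y => f (g y)) (a * b).
Proof.
move=> hf hg; have cg := cder_continuous hg.
move/caratheodory: hf => [p [<- pc hp]]; move/caratheodory: hg => [q [<- qc hq]].
apply/caratheodory; exists (fun y => p (g y) * q y); split; first by [].
  by apply: (@cvgM _ _ (nbhs z)); [exact: (cvg_comp _ _ cg pc) | exact: qc].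
by move=> y; rewrite hp hq mulrA.
Qed.

Lemma cderV (f : C -> C) z a : f z != 0 -> is_derive z (1 : C) f a ->
  is_derive z (1 : C) (fun y => (f y)^-1) (- a / f z ^+ 2).
Proof.
have inv0 (w : C) : w != 0 -> is_derive w (1 : C) (fun y => y^-1) (- w ^- 2).
  move=> w0; apply/caratheodory.
  (* The factorisation must also hold at y = 0, where y^-1 is 0. *)
  exists (fun y => if y == 0 then w ^- 2 else - (w * y)^-1).
  split; first by rewrite (negPf w0) -expr2.
    rewrite (negPf w0).
    have h : - (w * y)^-1 @[y --> w] --> - (w * w)^-1.
      apply: (@cvgN _ _ _ (nbhs w)); apply: (@cvgV _ _ (nbhs w)).
        by rewrite mulf_neq0.
      by apply: (@cvgM _ _ (nbhs w)); [exact: cvg_cst | exact: cvg_id].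
    apply/(cvgCP (F := nbhs w)) => e e0; move/(cvgCP (F := nbhs w)): h => /(_ e e0).
    have n0 : \forall y \near w, y != 0.
      apply/nbhsCP; exists (normc w).
        by rewrite lt_neqAle normc_ge0 andbT eq_sym; apply: contraNneq w0 => /Normc.eq0_normc ->.
      move=> y; apply: contraTneq => ->; by rewrite sub0r normcN ltxx.
    by apply: filterS2 n0 => y /negPf ->.
  move=> y; case: eqP => [->|/eqP y0]; first by rewrite invr0 sub0r sub0r; field.
  by field; rewrite w0 y0.
move=> f0 h; have := cder_comp (inv0 _ f0) h.
by rewrite mulrC mulrN mulNr.
Qed.

End CTop.

(** * The complex exponential *)

Section CExp.
Variable R : realType.
Local Notation C := (R[i]^o).
Local Notation normc := Normc.normc.

Lemma normc_Re_le (z : R[i]) : `|complex.Re z| <= normc z.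
Proof. by rewrite -lecR -cnormE; exact: normc_ge_Re. Qed.

Lemma normc_i : normc ('i%C : R[i]) = 1.
Proof. by rewrite /= expr0n /= expr1n add0r sqrtr1. Qed.

Lemma normc_Im_le (z : R[i]) : `|complex.Im z| <= normc z.
Proof.
have := normc_Re_le (z * 'i%C); rewrite ReiNIm normrN Normc.normcM.
by rewrite normc_i mulr1.
Qed.

Lemma normc_real (x : R) : normc x%:C = `|x|.
Proof. by rewrite /= expr0n /= addr0 sqrtr_sqr. Qed.

Lemma normc_le_ReIm (z : R[i]) : normc z <= `|complex.Re z| + `|complex.Im z|.
Proof.
rewrite {1}[z]complexE; apply: le_trans (le_normcD _ _) _.
rewrite Normc.normcM !normc_real.
by rewrite normc_i mul1r.
Qed.

Lemma real_first_order (f : R -> R) (df : R) : is_derive (0 : R) (1 : R) f df ->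
  forall e : R, 0 < e -> exists2 d : R, 0 < d &
    forall h, `|h| < d -> `|f h - f 0 - df * h| <= e * `|h|.
Proof.
case=> /cvg_ex[l hl] hd e e0.
have ld : l = df by rewrite -hd; apply/esym/cvg_lim.
move/cvgrPdist_le : hl => /(_ e e0).
rewrite nearE => /(nbhs_normP (0:R)) [d d0 hd']; exists d => // h hlt.
have [->|h0] := eqVneq h 0; first by rewrite subrr mulr0 subrr normr0 mulr0.
have := hd' h; rewrite /= sub0r normrN => /(_ hlt h0).
rewrite ld addr0 [h *: 1]mulr1 => hh.
have -> : f h - f 0 - df * h = - ((df - h^-1 *: (f h - f 0)) * h).
  by rewrite /GRing.scale /=; field.
by rewrite normrN normrM ler_wpM2r.
Qed.

Lemma cexpD (a b : C) : cexp (a + b) = cexp a * cexp b :> C.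
Proof.
case: a b => [a1 a2] [b1 b2]; rewrite /cexp /= expRD cosD sinD.
by apply/eqP; rewrite eq_complex /=; apply/andP; split; apply/eqP; ring.
Qed.

Lemma cexp0 : cexp (0 : C) = 1.
Proof.
by rewrite /cexp /= expR0 cos0 sin0; apply/eqP; rewrite eq_complex /=; apply/andP; split; apply/eqP; ring.
Qed.

Lemma normc_cexp (z : C) : normc (cexp z) = expR (complex.Re z).
Proof.
rewrite /cexp Normc.normcM normc_real ger0_norm ?expR_ge0 //.
by rewrite /Normc.normc cos2Dsin2 sqrtr1 mulr1.
Qed.

Lemma cexp_neq0 (z : C) : cexp z != 0 :> C.
Proof.
apply/eqP => h; have := normc_cexp z; rewrite h Normc.normc0 => /esym h'.
by have := expR_gt0 (complex.Re z); rewrite h' ltxx.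
Qed.

Lemma cexpN (z : C) : cexp (- z) = (cexp z)^-1 :> C.
Proof.
apply: (mulfI (cexp_neq0 z)); rewrite -cexpD subrr cexp0 mulfV //.
exact: cexp_neq0.
Qed.

(** For z = x + iy the first-order errors of exp x, cos y and sin y are at
    most c |z|, and their contributions to cexp z - 1 - z add up to at most 7 c |z|. *)
Lemma cexp_first_order (e : R) : 0 < e -> exists2 d : R, 0 < d &
  forall z : C, normc z < d -> normc (cexp z - 1 - z) <= e * normc z.
Proof.
move=> e0; pose c := Num.min (e / 7) 1.
have c1 : c <= 1 by rewrite ge_min lexx orbT.
have ce : 7 * c <= e by rewrite -ler_pdivlMl // mulrC ge_min lexx.
have c0 : 0 < c by rewrite lt_min divr_gt0 //= ltr01.
clearbody c; have [d1 d10 h1] := real_first_order (is_derive_expR (0:R)) c0.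
have [d2 d20 h2] := real_first_order (is_derive_cos (0:R)) c0.
have [d3 d30 h3] := real_first_order (is_derive_sin (0:R)) c0.
exists (Num.min (Num.min d1 d2) (Num.min d3 c)).
  by rewrite !lt_min d10 d20 d30 c0.
move=> z; rewrite !lt_min => /andP[/andP[z1 z2] /andP[z3 zc]].
have xz := normc_Re_le z; have yz := normc_Im_le z.
have zn := normc_ge0 z.
move: h1 => /(_ _ (le_lt_trans xz z1)) h1.
move: h2 => /(_ _ (le_lt_trans yz z2)) h2.
move: h3 => /(_ _ (le_lt_trans yz z3)) h3.
have sn : `|sin (complex.Im z)| <= 1 by exact: sin_max.
have cn : `|cos (complex.Im z)| <= 1 by exact: cos_max.
apply: le_trans (normc_le_ReIm _) _.
apply: le_trans (_ : 7 * c * normc z <= _); last by rewrite ler_wpM2r.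
move: h1 h2 h3; rewrite expR0 cos0 sin0 oppr0 mul0r mul1r !subr0 => h1 h2 h3.
case: z z1 z2 z3 zc xz yz zn h1 h2 h3 sn cn => x y /=; set N := Num.sqrt _.
rewrite !mul0r !(addr0, subr0, mul1r, mulr0) => _ _ _ zc xz yz zn h1 h2 h3 sn cn.
set E := expR x - 1 - x in h1 *.
set c1' := cos y - 1 in h2 *.
set S := sin y - y in h3 *.
have -> : expR x * cos y - 1 - x = E * cos y + (1 + x) * c1' by rewrite /E /c1'; ring.
have -> : expR x * sin y - y = E * sin y + (1 + x) * S + x * y by rewrite /E /S; ring.
have x1 : `|1 + x| <= 2.
  by apply: le_trans (ler_normD _ _) _; rewrite normr1; lra.
have k1 : `|E * cos y| <= c * N.
  rewrite normrM; apply: le_trans (ler_wpM2l _ cn) _ => //.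
  by rewrite mulr1; apply: le_trans h1 _; rewrite ler_wpM2l // ltW.
have k2 : `|E * sin y| <= c * N.
  rewrite normrM; apply: le_trans (ler_wpM2l _ sn) _ => //.
  by rewrite mulr1; apply: le_trans h1 _; rewrite ler_wpM2l // ltW.
have k3 : `|(1 + x) * c1'| <= 2 * (c * N).
  rewrite normrM; apply: ler_pM => //; apply: le_trans h2 _.
  by rewrite ler_wpM2l // ltW.
have k4 : `|(1 + x) * S| <= 2 * (c * N).
  rewrite normrM; apply: ler_pM => //; apply: le_trans h3 _.
  by rewrite ler_wpM2l // ltW.
have k5 : `|x * y| <= c * N.
  by rewrite normrM; apply: ler_pM => //; exact: le_trans xz (ltW zc).
have t1 := ler_normD (E * cos y) ((1 + x) * c1').
have t2 := ler_normD (E * sin y + (1 + x) * S) (x * y).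
have t3 := ler_normD (E * sin y) ((1 + x) * S).
lra.
Qed.

Lemma cder_cexp (z : C) : is_derive z (1 : C) (@cexp R) (cexp z).
Proof.
apply/caratheodory.
exists (fun y => if y == z then cexp z else (cexp y - cexp z) / (y - z)).
rewrite eqxx; split; first by [].
  apply/(cvgCP (F := nbhs z)) => e e0.
  have k0 : 0 < normc (cexp z) by rewrite normc_cexp expR_gt0.
  have k1 : 0 < e / (2 * normc (cexp z)) by rewrite divr_gt0 // mulr_gt0.
  have [d d0 h] := cexp_first_order k1.
  apply/nbhsCP; exists d => // y hy; case: eqP => [_|/eqP yz].
    by rewrite subrr Normc.normc0.
  have w0 : y - z != 0 by rewrite subr_eq0.
  have -> : (cexp y - cexp z) / (y - z) - cexp z =
            cexp z * ((cexp (y - z) - 1 - (y - z)) / (y - z)).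
    rewrite -{1}[y](subrK z) cexpD; set a := cexp (_ - _); set b := cexp z.
    by field.
  rewrite Normc.normcM [X in _ * X]Normc.normcM Normc.normcV.
  have := h _ hy; set n := normc (y - z) => hn.
  have n0 : 0 < n.
    rewrite lt_neqAle normc_ge0 andbT eq_sym; apply: contraNneq w0 => h0.
    by apply/eqP/Normc.eq0_normc.
  apply: le_lt_trans (_ : _ <= normc (cexp z) * (e / (2 * normc (cexp z)))) _.
    by apply: ler_wpM2l; [exact: normc_ge0 | rewrite ler_pdivrMr].
  have -> : normc (cexp z) * (e / (2 * normc (cexp z))) = e / 2.
    by field; rewrite gt_eqF.
  lra.
by move=> y; case: eqP => [->|/eqP yz]; rewrite ?subrr ?mulr0 // divfK ?subr_eq0.
Qed.

Lemma cder_poly (p : {poly R[i]}) (z : C) :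
  is_derive z (1 : C) (fun y : C => p.[y] : C) (p^`().[z]).
Proof.
elim/poly_ind: p => [|p c IH].
  rewrite (_ : (fun _ => _) = fun=> 0); last by apply/funext => y; rewrite horner0.
  by rewrite linear0 horner0; exact: cder_cst.
rewrite (_ : (fun _ => _) = fun y : C => p.[y] * y + c); last first.
  by apply/funext => y; rewrite !hornerE.
rewrite derivD derivM derivX derivC !hornerE.
have := cderD (cderM IH (cder_id z)) (cder_cst c z).
by rewrite addr0 mulr1.
Qed.

End CExp.

(** * Determinations of the logarithm *)

Section Log.
Variable R : realType.
Local Notation C := (R[i]^o).
Local Notation normc := Normc.normc.

Lemma normc_gt0 (z : R[i]) : (0 < normc z) = (z != 0).
Proof.
rewrite lt_neqAle normc_ge0 andbT eq_sym; congr (~~ _).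
by apply/eqP/eqP => [/Normc.eq0_normc|->] //; exact: Normc.normc0.
Qed.

(** For w = z / u, both |Im w| and - Re w bound the distance of w to the
    half-line of nonnegative reals from below, and one of them is positive when z
    lies off the cut. *)
Lemma slit_open (u : C) : u != 0 -> open (slit_plane u).
Proof.
move=> u0; rewrite openE => z zu; apply/nbhsCP.
pose w : R[i] := z / u; pose r := Num.max `|complex.Im w| (- complex.Re w).
have r0 : 0 < r.
  rewrite lt_max; case: (eqVneq (complex.Im w) 0) => [h|h]; last by rewrite normr_gt0 h.
  apply/orP; right; rewrite oppr_gt0 ltNge; apply/negP => h'.
  apply: (zu _ h'); have -> : (complex.Re w)%:C = w.
    by rewrite [RHS]complexE h mulr0 addr0.
  by rewrite /w divfK.
exists (r * normc u); first by rewrite mulr_gt0 // normc_gt0.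
move=> y yr t t0 yE; move: yr.
have -> : y - z = (t%:C - w) * u by rewrite yE /w mulrBl divfK.
rewrite Normc.normcM ltr_pM2r ?normc_gt0 // ltNge => /negP; apply.
rewrite ge_max; apply/andP; split.
  by apply: le_trans (normc_Im_le _); rewrite raddfB /= sub0r normrN.
apply: le_trans (normc_Re_le _); rewrite raddfB /=.
by apply: le_trans (ler_norm _); rewrite -[X in X <= _]add0r lerD2r.
Qed.

Lemma slit_neq0 (u z : C) : slit_plane u z -> z != 0.
Proof.
by move=> h; apply/eqP => z0; apply: (h 0) => //; rewrite mul0r.
Qed.

Lemma slit_opp (u : C) (t : R) : u != 0 -> 0 < t -> slit_plane u (t%:C * - u).
Proof.
move=> u0 t0 s s0; rewrite mulrN -mulNr => /(mulIf u0) /(congr1 (@complex.Re R)) /= h.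
by move: s0; rewrite -h oppr_ge0 leNgt t0.
Qed.

Variables (u : C) (L : C -> C).
Hypotheses (u0 : u != 0) (hL : log_determination u L).

Lemma log_continuous z : slit_plane u z -> L y @[y --> z] --> L z.
Proof.
case: hL => + _ zu; rewrite (continuous_open_subspace _ (slit_open u0)).
by apply; rewrite inE.
Qed.

(** A determination is a continuous right inverse of cexp.  In the
    factorisation cexp w - cexp (L z) = p w (w - L z), the factor p (L y) tends to
    p (L z) = z, which is nonzero, so L y - L z is (y - z) / p (L y). *)
Lemma cder_log (z : C) : slit_plane u z -> is_derive z (1 : C) L z^-1.
Proof.
move=> zu; have [_ hE] := hL; have z0 := slit_neq0 zu.
have /caratheodory[p [pz pc hp]] := cder_cexp (L z).
rewrite (hE z zu) in pz; apply/caratheodory.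
exists (fun y => if pselect (slit_plane u y) then (p (L y))^-1 else (L y - L z) / (y - z)).
case: pselect => [zu'|//] /=; rewrite pz; split; first by [].
  have h : (p (L y))^-1 @[y --> z] --> (p (L z))^-1.
    apply: (@cvgV _ _ (nbhs z)); first by rewrite pz.
    exact: (cvg_comp _ _ (log_continuous zu) pc).
  rewrite pz in h.
  apply/(cvgCP (F := nbhs z)) => e e0; move/(cvgCP (F := nbhs z)): h => /(_ e e0).
  have := slit_open u0; rewrite openE => /(_ _ zu).
  by apply: filterS2 => y yu; case: pselect.
move=> y; case: pselect => [yu|yu] /=; last first.
  by rewrite divfK // subr_eq0; apply/eqP => yz; apply: yu; rewrite yz.
have := hp (L y); rewrite (hE z zu) (hE y yu) => yz; rewrite yz.
have [p0|p0] := eqVneq (p (L y)) 0.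
  move: yz; rewrite p0 mul0r => /eqP; rewrite subr_eq0 => /eqP yz.
  by move: z0; rewrite -pz -yz p0 eqxx.
by rewrite mulrA mulVf // mul1r.
Qed.

(** A determination is only known up to multiples of 2 pi i.  Along the ray
    opposite to the cut its difference to the expected value is purely imaginary,
    continuous, vanishes at t = 0 and has zero sine; the intermediate value theorem
    keeps it equal to 0. *)
Lemma log_on_ray (t : R) : 0 <= t ->
  L ((expR (- t))%:C * - u) = L (- u) - t%:C.
Proof.
have [_ hE] := hL.
have ray (s : R) : slit_plane u ((expR (- s))%:C * - u).
  by apply: slit_opp => //; exact: expR_gt0.
pose D (s : R) : C := L ((expR (- s))%:C * - u) - L (- u) + s%:C.
have one : (1 : R[i]) = (expR (- 0))%:C by rewrite oppr0 expR0.
have D1 s : cexp (D s) = 1.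
  have r0 : slit_plane u (- u) by move: (ray 0); rewrite -one mul1r.
  rewrite /D !cexpD cexpN (hE _ (ray s)) (hE _ r0).
  have -> : cexp (s%:C : C) = (expR s)%:C.
    rewrite /cexp /= cos0 sin0 (_ : 1 +i* 0 = 1 :> R[i]) // mulr1 //.
  rewrite mulfK ?oppr_eq0 // -rmorphM /= -expRD addNr expR0 //.
have sD s : sin (complex.Im (D s)) = 0.
  have := congr1 (@complex.Im R) (D1 s); rewrite /cexp /= mul0r addr0.
  move/eqP; rewrite mulf_eq0 gt_eqF ?expR_gt0 //= => /eqP //.
have rD s : complex.Re (D s) = 0.
  by apply: expR_inj; rewrite expR0 -normc_cexp D1 Normc.normc1.
have D0 : D 0 = 0 by rewrite /D -one mul1r subrr add0r.
have contD : continuous (fun s => `|complex.Im (D s)|).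
  move=> s; apply: (@cvg_norm _ _ _ (nbhs s)).
  have c1 : ((expR (- x))%:C * - u : C) @[x --> s] --> ((expR (- s))%:C * - u : C).
    apply: (@cvgM _ _ (nbhs s)); last exact: cvg_cst.
    apply/(cvgCP (F := nbhs s)) => e e0.
    have : expR (- x) @[x --> s] --> expR (- s).
      apply: (@continuous_comp _ _ _ (fun x : R => - x) (@expR R)).
        by apply: (@cvgN _ _ _ (nbhs s)); exact: cvg_id.
      exact: continuous_expR.
    move/cvgrPdist_lt => /(_ e e0); apply: filterS => x.
    by rewrite -rmorphB normc_real distrC.
  have := cvg_comp _ _ c1 (log_continuous (ray s)).
  move/(cvgCP (F := nbhs s)) => c2.
  apply/cvgrPdist_lt => e e0; apply: filterS (c2 e e0) => x /= hx.
  rewrite distrC; apply: le_lt_trans hx; apply: le_trans (normc_Im_le _).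
  rewrite /D; case: (L _) => a1 b1; case: (L _) => a2 b2; case: (L _) => a3 b3 /=.
  by rewrite le_eqVlt; apply/orP; left; apply/eqP; congr `|_|; ring.
move=> t0; suff : D t = 0.
  by rewrite /D => /eqP; rewrite addr_eq0 subr_eq => /eqP ->; rewrite addrC.
apply/eqP; rewrite eq_complex rD eqxx /= -normr_eq0; apply/negPn/negP => h0.
have hp : 0 < `|complex.Im (D t)| by rewrite lt_neqAle eq_sym h0 normr_ge0.
pose v := Num.min `|complex.Im (D t)| 1.
have v0 : 0 < v by rewrite lt_min hp ltr01.
have [||c _ hc] := @IVT R (fun s => `|complex.Im (D s)|) 0 t v t0.
- by apply: continuous_subspaceT => x; exact: contD.
- rewrite D0 /= normr0 (min_idPl (ltW hp)) (max_idPr (ltW hp)) ltW //=.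
  by rewrite ge_min lexx.
have : 0 < sin v.
  apply: sin_gt0_pi; rewrite v0 /=; apply: le_lt_trans (_ : _ <= 1) _.
    by rewrite ge_min lexx orbT.
  by apply: lt_le_trans (pi_ge2 R); rewrite ltr1n.
rewrite -hc; case: (leP 0 (complex.Im (D c))) => h.
  by rewrite ger0_norm // sD ltxx.
by rewrite ltr0_norm // sinN sD oppr0 ltxx.
Qed.

End Log.

(** * Sums of power series *)

Section PS.
Variable R : realType.
Local Notation C := (R[i]^o).
Local Notation normc := Normc.normc.

Lemma limn_unique (u : nat -> C) (l : C) : u @ \oo --> l -> limn u = l.
Proof. by move=> h; apply: cvg_lim. Qed.

Lemma normc_lim_le (u : nat -> C) (l : C) (M : R) :
  u @ \oo --> l -> (forall n, normc (u n) <= M) -> normc l <= M.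
Proof.
move=> /(cvgCP (F := \oo)) h hM; apply/ler_addgt0Pr => e e0.
have [n _ /(_ n (leqnn n)) /= hn] := h e e0.
have -> : l = u n + - (u n - l) by rewrite opprB addrC subrK.
by apply: le_trans (le_normcD _ _) _; rewrite normcN lerD // ltW.
Qed.

(** Absolute convergence is tested on the real and imaginary parts. *)
Lemma series_dominated (u : nat -> C) (v : nat -> R) (S : R) :
  (forall n, normc (u n) <= v n) -> series v @ \oo --> S ->
  exists2 l : C, series u @ \oo --> l & normc l <= S.
Proof.
move=> uv vS.
have v0 n : 0 <= v n by apply: le_trans (uv n); exact: normc_ge0.
have part (f : R[i] -> R) : (forall z, `|f z| <= normc z) ->
    cvgn (series (fun n => f (u n))).
  move=> hf; apply: normed_cvg.
  apply: (@series_le_cvg _ _ v); last by apply/cvg_ex; exists S.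
  - by move=> n; exact: normr_ge0.
  - exact: v0.
  - by move=> n; apply: le_trans (hf _) (uv n).
have /cvg_ex[x hx] := part _ (@normc_Re_le R).
have /cvg_ex[y hy] := part _ (@normc_Im_le R).
have serE n : series u n = series (fun n => complex.Re (u n)) n
    +i* series (fun n => complex.Im (u n)) n.
  elim: n => [|n IH]; first by rewrite !/series /= !big_geq.
  by rewrite !seriesSr IH; case: (u n).
have cv : series u @ \oo --> (x +i* y : C).
  apply/(cvgCP (F := \oo)) => e e0.
  have e2 : 0 < e / 2 by rewrite divr_gt0.
  move/cvgrPdist_lt: hx => /(_ (e / 2) e2) hx.
  move/cvgrPdist_lt: hy => /(_ (e / 2) e2) hy.
  apply: filterS2 hx hy => n hx hy; rewrite serE.
  apply: le_lt_trans (normc_le_ReIm _) _ => /=.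
  by rewrite [e]splitr; apply: ltrD; rewrite distrC.
exists (x +i* y) => //; apply: normc_lim_le cv _ => n.
apply: le_trans (_ : series v n <= _).
  elim: n => [|n IH]; first by rewrite /series /= !big_geq // Normc.normc0.
  by rewrite !seriesSr; apply: le_trans (le_normcD _ _) _; exact: lerD.
have nd : nondecreasing_seq (series v).
  by apply/nondecreasing_seqP => m; rewrite seriesSr lerDl.
rewrite -(cvg_lim (@Rhausdorff R) vS).
by apply: nondecreasing_cvgn_le => //; apply/cvg_ex; exists S.
Qed.

(** The exponent n + 1 is that of the growth condition on conjugates, so the
    coefficients of a series of arithmetic growth satisfy this bound as they stand. *)
Definition geom_bounded (a : nat -> C) : Prop :=
  exists2 B : R, 0 < B & forall n, normc (a n) <= B ^+ n.+1.

Definition cpsum (a : nat -> C) (z : C) : C :=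
  limn (series (fun n => a n * z ^+ n : C)).

Lemma normcX (z : R[i]) n : normc (z ^+ n) = normc z ^+ n.
Proof.
by elim: n => [|n IH]; rewrite ?expr0 ?Normc.normc1 // !exprS Normc.normcM IH.
Qed.

Lemma geo_half (B : R) : series (geometric B (1 / 2)) @ \oo --> 2 * B.
Proof.
have -> : 2 * B = B * (1 - 1 / 2)^-1 by field.
by apply: cvg_geometric_series; rewrite ger0_norm; lra.
Qed.

Lemma cpsum_cvg_bound (a : nat -> C) (B : R) (z : C) : 0 < B ->
  (forall n, normc (a n) <= B ^+ n.+1) -> normc z < (2 * B)^-1 ->
  (series (fun n => a n * z ^+ n : C) @ \oo --> cpsum a z) /\
  normc (cpsum a z) <= 2 * B.
Proof.
move=> B0 ha hz.
have [l hl lb] : exists2 l : C, series (fun n => a n * z ^+ n : C) @ \oo --> l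
    & normc l <= 2 * B.
  apply: (@series_dominated _ (geometric B (1 / 2))); last exact: geo_half.
  move=> n /=.
  rewrite Normc.normcM normcX.
  apply: le_trans (_ : B ^+ n.+1 * ((2 * B)^-1) ^+ n <= _).
    apply: ler_pM => //; rewrite ?normc_ge0 ?exprn_ge0 ?normc_ge0 //.
    by apply: lerXn2r; rewrite ?nnegrE ?normc_ge0 ?(ltW hz) // invr_ge0 mulr_ge0 // ltW.
  rewrite exprS -mulrA -exprMn le_eqVlt; apply/orP; left; apply/eqP.
  by congr (_ * _ ^+ _); field; rewrite gt_eqF.
by rewrite /cpsum (limn_unique hl).
Qed.

Lemma near0_small (r : R) : 0 < r -> \forall z \near (0 : C), normc z < r.
Proof. by move=> r0; apply/nbhsCP; exists r => // y; rewrite subr0. Qed.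

Lemma cpsum_cvg (a : nat -> C) : geom_bounded a ->
  \forall z \near (0 : C), series (fun n => a n * z ^+ n : C) @ \oo --> cpsum a z.
Proof.
case=> B B0 ha; have k0 : 0 < (2 * B)^-1 by rewrite invr_gt0 mulr_gt0.
by apply: filterS (near0_small k0) => z /(cpsum_cvg_bound B0 ha)[].
Qed.

Lemma cpsum_bounded (a : nat -> C) : geom_bounded a ->
  exists M : R, \forall z \near (0 : C), normc (cpsum a z) <= M.
Proof.
case=> B B0 ha; exists (2 * B); have k0 : 0 < (2 * B)^-1 by rewrite invr_gt0 mulr_gt0.
by apply: filterS (near0_small k0) => z /(cpsum_cvg_bound B0 ha)[].
Qed.

Lemma expr_sum_le (A B : R) n : 0 <= A -> 0 <= B -> A ^+ n.+1 + B ^+ n.+1 <= (A + B) ^+ n.+1.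
Proof.
move=> A0 B0; elim: n => [|n IH]; first by rewrite !expr1.
rewrite !(exprS _ n.+1); apply: le_trans (_ : (A + B) * (A ^+ n.+1 + B ^+ n.+1) <= _).
  rewrite mulrDl !mulrDr; have := mulr_ge0 A0 (exprn_ge0 n.+1 B0).
  have := mulr_ge0 B0 (exprn_ge0 n.+1 A0); lra.
by rewrite ler_wpM2l // addr_ge0.
Qed.

Lemma geom_boundedD a b : geom_bounded a -> geom_bounded b -> geom_bounded (fun n => a n + b n).
Proof.
move=> [A A0 ha] [B B0 hb]; exists (A + B); first exact: addr_gt0.
move=> n; apply: le_trans (le_normcD _ _) _.
apply: le_trans (expr_sum_le _ (ltW A0) (ltW B0)); exact: lerD.
Qed.

Lemma geom_boundedM (B : R) (c : nat -> C) a : 0 < B ->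
  (forall n, normc (c n) <= B ^+ n.+1) -> geom_bounded a -> geom_bounded (fun n => c n * a n).
Proof.
move=> B0 hc [A A0 ha]; exists (B * A); first exact: mulr_gt0.
move=> n; rewrite Normc.normcM exprMn; apply: ler_pM => //; exact: normc_ge0.
Qed.

Lemma geom_boundedZ (c : C) a : geom_bounded a -> geom_bounded (fun n => c * a n).
Proof.
apply: (@geom_boundedM (1 + normc c)); first by rewrite ltr_pwDl // normc_ge0.
move=> n; apply: le_trans (_ : (1 + normc c) ^+ 1 <= _).
  by rewrite expr1 lerDr.
by apply: ler_weXn2l => //; rewrite lerDl normc_ge0.
Qed.

Lemma geom_bounded0 : geom_bounded (fun=> 0).
Proof. by exists 1 => // n; rewrite Normc.normc0 expr1n. Qed.

Lemma geom_bounded_sum I (r : seq I) (a : I -> nat -> C) : (forall i, geom_bounded (a i)) ->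
  geom_bounded (fun n => \sum_(i <- r) a i n).
Proof.
move=> h; elim: r => [|i r IH].
  rewrite (_ : (fun _ => _) = fun=> 0); first exact: geom_bounded0.
  by apply/funext => n; rewrite big_nil.
rewrite (_ : (fun _ => _) = fun n => a i n + \sum_(i <- r) a i n).
  exact: geom_boundedD.
by apply/funext => n; rewrite big_cons.
Qed.

Lemma normc_nat (n : nat) : normc (n%:R : R[i]) = n%:R.
Proof. by rewrite -(rmorph_nat (real_complex R)) normc_real normr_nat. Qed.

Lemma geom_bounded_natM a (c : C) : geom_bounded a -> geom_bounded (fun n => (n%:R + c) * a n).
Proof.
move=> ha; rewrite (_ : (fun _ => _) = fun n => n%:R * a n + c * a n); last first.
  by apply/funext => n; rewrite mulrDl.
apply: geom_boundedD; last exact: geom_boundedZ.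
apply: (@geom_boundedM 2) => // n; rewrite normc_nat -natrX ler_nat.
by apply: leq_trans (ltnW (ltn_expl n (isT : (1 < 2)%N))) _; rewrite leq_exp2l.
Qed.

(** Multiplication of a power series by z. *)
Definition seq_shift (K : nzSemiRingType) (a : nat -> K) (n : nat) : K :=
  if n is m.+1 then a m else 0.

Lemma geom_bounded_shift a : geom_bounded a -> geom_bounded (seq_shift a).
Proof.
move=> [A A0 ha]; exists (1 + A); first by rewrite addr_gt0.
case=> [|n]; first by rewrite Normc.normc0 exprn_ge0 // addr_ge0 // ltW.
apply: le_trans (ha n) _; apply: le_trans (_ : (1 + A) ^+ n.+1 <= _).
  by apply: lerXn2r; rewrite ?nnegrE ?addr_ge0 ?ltW // ltrDr.
by apply: ler_weXn2l => //; rewrite lerDl ltW.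
Qed.

Lemma geom_bounded_tail a : geom_bounded a -> geom_bounded (fun n => a n.+1).
Proof.
move=> [A A0 ha]; exists ((1 + A) ^+ 2); first by rewrite exprn_gt0 // addr_gt0.
move=> n; apply: le_trans (ha n.+1) _; rewrite -exprM.
apply: le_trans (_ : (1 + A) ^+ n.+2 <= _).
  by apply: lerXn2r; rewrite ?nnegrE ?addr_ge0 ?ltW // ltrDr.
by apply: ler_weXn2l; [rewrite lerDl ltW | lia].
Qed.

Lemma cpsumD a b : geom_bounded a -> geom_bounded b -> \forall z \near (0 : C),
  cpsum (fun n => a n + b n) z = cpsum a z + cpsum b z.
Proof.
move=> /cpsum_cvg ha /cpsum_cvg hb; apply: filterS2 ha hb => z ha hb.
apply: limn_unique; rewrite (_ : series _ = fun n => series (fun n => a n * z ^+ n) n +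
   series (fun n => b n * z ^+ n) n).
  by apply: (@cvgD _ _ _ \oo); [exact: ha | exact: hb].
apply/funext => n; rewrite /series /= -big_split /=.
by apply: eq_bigr => i _; rewrite mulrDl.
Qed.

Lemma cpsumZ c a : geom_bounded a -> \forall z \near (0 : C),
  cpsum (fun n => c * a n) z = c * cpsum a z.
Proof.
move=> /cpsum_cvg ha; apply: filterS ha => z ha.
apply: limn_unique; rewrite (_ : series _ = fun n => c * series (fun n => a n * z ^+ n) n).
  by apply: (@cvgM _ _ \oo); [exact: cvg_cst | exact: ha].
apply/funext => n; rewrite /series /= big_distrr /=.
by apply: eq_bigr => i _; rewrite mulrA.
Qed.

Lemma cpsum0 z : cpsum (fun=> 0) z = 0.
Proof.
apply: limn_unique; rewrite (_ : series _ = fun=> 0); first exact: cvg_cst.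
by apply/funext => n; rewrite /series /= big1 // => i _; rewrite mul0r.
Qed.

Lemma cpsum_sum I (r : seq I) (a : I -> nat -> C) : (forall i, geom_bounded (a i)) ->
  \forall z \near (0 : C),
  cpsum (fun n => \sum_(i <- r) a i n) z = \sum_(i <- r) cpsum (a i) z.
Proof.
move=> h; elim: r => [|i r IH].
  rewrite (_ : (fun _ => _) = fun=> 0); last by apply/funext => n; rewrite big_nil.
  by apply: (@filterE _ (nbhs (0 : C))) => z; rewrite big_nil cpsum0.
rewrite (_ : (fun _ => _) = fun n => a i n + \sum_(i <- r) a i n); last first.
  by apply/funext => n; rewrite big_cons.
apply: filterS2 IH (cpsumD (h i) (geom_bounded_sum r h)) => z h1 ->.
by rewrite big_cons h1.
Qed.

Lemma cpsum_shift a : geom_bounded a -> \forall z \near (0 : C),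
  cpsum (seq_shift a) z = z * cpsum a z.
Proof.
move=> /cpsum_cvg ha; apply: filterS ha => z ha.
apply: limn_unique; rewrite -(cvg_shiftS (series _)).
rewrite (_ : (fun n => _) = fun n => z * series (fun n => a n * z ^+ n) n).
  by apply: (@cvgM _ _ \oo); [exact: cvg_cst | exact: ha].
apply/funext => n; rewrite /series /= big_nat_recl //= mul0r add0r big_distrr /=.
by apply: eq_bigr => i _; rewrite exprS; ring.
Qed.

Lemma seq_shift_tail a : a = (fun n => seq_shift (fun n => a n.+1) n + (if n is 0 then a 0 else 0)) :> (nat -> C).
Proof. by apply/funext => -[|n] /=; rewrite ?add0r ?addr0. Qed.

Lemma cpsum_const c z : cpsum (fun n => if n is 0 then c else 0) z = c.
Proof.
apply: limn_unique; rewrite -(cvg_shiftS (series _)).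
rewrite (_ : (fun n => _) = fun n => c); first exact: cvg_cst.
apply/funext => n; rewrite /series /= big_nat_recl //= expr0 mulr1 big1 ?addr0 //.
by move=> i _; rewrite mul0r.
Qed.

Lemma geom_bounded_const c : geom_bounded (fun n => if n is 0 then c else 0).
Proof.
exists (1 + normc c); first by rewrite ltr_pwDl // normc_ge0.
case=> [|n]; first by rewrite expr1 lerDr.
by rewrite Normc.normc0 exprn_ge0 // addr_ge0 // normc_ge0.
Qed.

Lemma cpsum_tail a : geom_bounded a -> \forall z \near (0 : C),
  cpsum a z = a 0 + z * cpsum (fun n => a n.+1) z.
Proof.
move=> ha; have ht := geom_bounded_tail ha.
apply: filterS2 (cpsum_shift ht) (cpsumD (geom_bounded_shift ht) (geom_bounded_const (a 0))) => z h1 h2.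
by rewrite {1}[a]seq_shift_tail h2 h1 cpsum_const addrC.
Qed.

(** With E n the expression inside the norm on the left,
    E (n+1) = y E n + n z^n (y - z)^2.  It is z times the Taylor remainder of z^n,
    which keeps the exponent n - 1 out of the estimate. *)
Lemma theta_first_order (y z : C) (r : R) n : 0 < r -> normc y <= r -> normc z <= r ->
  normc (z * (y ^+ n - z ^+ n) - n%:R * z ^+ n * (y - z))
    <= (2 * r) ^+ n * r^-1 * normc (y - z) ^+ 2.
Proof.
move=> r0 hy hz; set d := normc (y - z).
have d0 : 0 <= d ^+ 2 by rewrite exprn_ge0 // normc_ge0.
elim: n => [|n IH].
  rewrite !expr0 subrr mulr0 !mul0r subrr Normc.normc0 mul1r.
  by rewrite mulr_ge0 // invr_ge0 ltW.
have -> : z * (y ^+ n.+1 - z ^+ n.+1) - n.+1%:R * z ^+ n.+1 * (y - z) =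
  y * (z * (y ^+ n - z ^+ n) - n%:R * z ^+ n * (y - z)) + n%:R * z ^+ n * (y - z) ^+ 2.
  by rewrite !exprS -natr1; ring.
apply: le_trans (le_normcD _ _) _; rewrite Normc.normcM.
apply: le_trans (_ : r * ((2 * r) ^+ n * r^-1 * d ^+ 2) + (2 * r) ^+ n * d ^+ 2 <= _).
  apply: lerD; first by apply: ler_pM; rewrite ?normc_ge0.
  rewrite !Normc.normcM !normcX normc_nat -/d; apply: ler_wpM2r => //.
  rewrite exprMn; apply: ler_pM; rewrite ?ler0n ?exprn_ge0 ?normc_ge0 //.
    by rewrite -natrX ler_nat ltnW // ltn_expl.
  by apply: lerXn2r; rewrite ?nnegrE ?normc_ge0 // ltW.
rewrite le_eqVlt; apply/orP; left; apply/eqP; rewrite !exprS.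
by field; rewrite gt_eqF.
Qed.

(** Summed against the coefficients, [theta_first_order] bounds
    z (f y - f z) - (theta f)(z) (y - z) by a multiple of |y - z|^2, where
    theta = z d/dz multiplies the n-th coefficient by n. *)
Lemma cder_cpsum a : geom_bounded a -> \forall z \near (0 : C), z != 0 ->
  is_derive (z : C) (1 : C) (cpsum a) (cpsum (fun n => n%:R * a n) z / z).
Proof.
move=> ca; have [B B0 ha] := ca; pose r := (4 * B)^-1.
have r0 : 0 < r by rewrite invr_gt0 mulr_gt0.
have ct : geom_bounded (fun n => n%:R * a n).
  by have := geom_bounded_natM 0 ca; under eq_fun do rewrite addr0.
have rB : r < (2 * B)^-1.
  by rewrite ltf_pV2 ?posrE ?mulr_gt0 // ltr_pM2r // ltr_nat.
apply: filterS2 (near0_small r0) (cpsum_cvg ct) => z zr ctz z0.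
pose t := cpsum (fun n => n%:R * a n) z; pose M := 2 * B * r^-1.
have key y : normc y < r ->
  normc (z * (cpsum a y - cpsum a z) - t * (y - z)) <= M * normc (y - z) ^+ 2.
  move=> yr; set d := normc (y - z).
  have [cy _] := cpsum_cvg_bound B0 ha (lt_trans yr rB).
  have [cz _] := cpsum_cvg_bound B0 ha (lt_trans zr rB).
  have dom n : normc (a n * (z * (y ^+ n - z ^+ n) - n%:R * z ^+ n * (y - z)))
      <= geometric (B * (r^-1 * d ^+ 2)) (1 / 2) n.
    rewrite /= Normc.normcM.
    apply: le_trans (_ : B ^+ n.+1 * ((2 * r) ^+ n * r^-1 * d ^+ 2) <= _).
      apply: ler_pM; rewrite ?normc_ge0 //.
      by apply: theta_first_order => //; exact: ltW.
    rewrite le_eqVlt; apply/orP; left; apply/eqP; rewrite exprS.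
    have -> : 1 / 2 = B * (2 * r) by rewrite /r; field; rewrite gt_eqF.
    by rewrite !exprMn; ring.
  have [l hl lb] := series_dominated dom (@geo_half _).
  have sumE : series (fun n => a n * (z * (y ^+ n - z ^+ n) - n%:R * z ^+ n * (y - z)))
     @ \oo --> (z * (cpsum a y - cpsum a z) - t * (y - z) : C).
    rewrite (_ : series _ = fun n => z * (series (fun n => a n * y ^+ n) n
       - series (fun n => a n * z ^+ n) n) - series (fun n => n%:R * a n * z ^+ n) n * (y - z)).
      apply: (@cvgB _ _ _ \oo).
        apply: (@cvgM _ _ \oo); first exact: cvg_cst.
        by apply: (@cvgB _ _ _ \oo); [exact: cy | exact: cz].
      by apply: (@cvgM _ _ \oo); [exact: ctz | exact: cvg_cst].
    apply/funext => n; rewrite /series /= -sumrB big_distrr big_distrl /= -sumrB.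
    by apply: eq_bigr => i _; ring.
  rewrite -(limn_unique sumE) (limn_unique hl).
  by apply: le_trans lb _; rewrite /M le_eqVlt; apply/orP; left; apply/eqP; ring.
apply/caratheodory.
exists (fun y => if y == z then t / z else (cpsum a y - cpsum a z) / (y - z)).
rewrite eqxx; split; first by [].
  apply/(cvgCP (F := nbhs (z : C)) _ (t / z : C)) => e e0.
  have nz0 : 0 < normc z by rewrite normc_gt0.
  have M0 : 0 < M by rewrite !mulr_gt0 // invr_gt0.
  pose d := Num.min (r - normc z) (e * normc z / M).
  have d0 : 0 < d by rewrite lt_min subr_gt0 zr !mulr_gt0 // invr_gt0.
  apply/nbhsCP; exists d => // y; rewrite lt_min => /andP[yz1 yz2].
  case: eqP => [_|/eqP yz]; first by rewrite subrr Normc.normc0.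
  have w0 : y - z != 0 by rewrite subr_eq0.
  have yr : normc y < r.
    rewrite -[y](subrK z); apply: le_lt_trans (le_normcD _ _) _.
    by rewrite -ltrBrDr.
  have -> : (cpsum a y - cpsum a z) / (y - z) - t / z =
     (z * (cpsum a y - cpsum a z) - t * (y - z)) / (z * (y - z)).
    by move: (cpsum a y) (cpsum a z) (t) => fy fz th; field; rewrite w0.
  rewrite Normc.normcM Normc.normcV [normc (z * _)]Normc.normcM.
  rewrite ltr_pdivrMr ?mulr_gt0 ?normc_gt0 //.
  apply: le_lt_trans (key _ yr) _.
  rewrite expr2 !mulrA ltr_pM2r ?normc_gt0 //.
  by rewrite mulrC -(ltr_pdivlMr _ _ M0); exact: yz2.
move=> y; case: eqP => [->|/eqP yz]; first by rewrite !subrr mulr0.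
by rewrite divfK; [exact: erefl | rewrite subr_eq0].
Qed.

End PS.

(** * Independence of powers of z and of the logarithm *)

Section Indep.
Variable R : realType.
Local Notation C := (R[i]^o).
Local Notation normc := Normc.normc.

(** If c is the constant coefficient of p, then (p(l) - c) / l tends to 0
    too; by induction this quotient is the zero polynomial, and then so is c. *)
Lemma poly_tends0 (l : nat -> C) (p : {poly R[i]}) :
  (fun n => (l n)^-1) @ \oo --> (0 : C) ->
  (\forall n \near \oo, l n != 0) ->
  (fun n => p.[l n] : C) @ \oo --> (0 : C) -> p = 0.
Proof.
move=> li ln0; elim/poly_ind: p => [//|p c IH] hp.
have p0 : p = 0.
  apply: IH.
  have h : (fun n => ((p * 'X + c%:P).[l n] - c : C) * (l n)^-1) @ \oo --> ((0 - c) * 0 : C).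
    apply: (@cvgM _ _ \oo); last exact: li.
    by apply: (@cvgB _ _ _ \oo); [exact: hp | exact: cvg_cst].
  rewrite mulr0 in h; apply/(cvgCP (F := \oo)) => e e0.
  move/(cvgCP (F := \oo)): h => /(_ e e0); apply: filterS2 ln0 => n ln.
  by rewrite !hornerE addrK mulfK.
rewrite p0 mul0r add0r in hp *; have : (fun n : nat => c : C) @ \oo --> (0 : C).
  apply/(cvgCP (F := \oo)) => e e0; move/(cvgCP (F := \oo)): hp => /(_ e e0).
  by apply: filterS => n; rewrite hornerC.
by move/limn_unique; rewrite (limn_unique (cvg_cst _)) => ->.
Qed.

(** For k = j + 1 and x = n + 1, exp x = exp(x/k)^k >= (x/k)^k, which
    exceeds x^j by one power of x. *)
Lemma expR_decay (j n : nat) :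
  (n.+1%:R : R) ^+ j * expR (- n%:R) <= j.+1%:R ^+ j.+1 * expR 1 * n.+1%:R^-1.
Proof.
have h : (n.+1%:R / j.+1%:R : R) ^+ j.+1 <= expR n.+1%:R.
  have -> : expR n.+1%:R = expR (n.+1%:R / j.+1%:R) ^+ j.+1 :> R.
    by rewrite -expRM_natl mulrC divfK.
  apply: lerXn2r; rewrite ?nnegrE ?expR_ge0 ?divr_ge0 //.
  by apply: le_trans (expR_ge1Dx _); rewrite lerDr.
have -> : expR (- n%:R) = expR 1 / expR (n.+1%:R) :> R.
  by rewrite -expRN -expRD; congr expR; rewrite -natr1; ring.
rewrite ler_pdivlMr // mulrA mulrAC ler_pdivrMr ?expR_gt0 //.
have -> : (n.+1%:R : R) ^+ j * expR 1 * n.+1%:R =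
   j.+1%:R ^+ j.+1 * expR 1 * (n.+1%:R / j.+1%:R : R) ^+ j.+1.
  rewrite expr_div_n (exprSr n.+1%:R) mulrCA -mulrA.
  have k0 : (j.+1%:R : R) ^+ j.+1 != 0 by rewrite expf_neq0 // pnatr_eq0.
  move: k0; set k := _ ^+ j.+1; set a := n.+1%:R; set b := a ^+ j => k0.
  by field.
by rewrite ler_wpM2l // mulr_ge0 ?expR_ge0 // exprn_ge0.
Qed.

Lemma expRN_tends0 : (fun n : nat => (expR (- n%:R))%:C : C) @ \oo --> (0 : C).
Proof.
apply/(cvgCP (F := \oo)) => e e0; apply: filterS (nbhs_infty_gtr e^-1) => n hn.
rewrite subr0 normc_real ger0_norm ?expR_ge0 // expRN.
rewrite invf_plt ?posrE ?expR_gt0 //; apply: lt_le_trans hn _.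
by apply: le_trans (expR_ge1Dx _); rewrite lerDr.
Qed.

Lemma near0_seq (P : C -> Prop) (x : nat -> C) : x @ \oo --> (0 : C) ->
  (\forall z \near (0 : C), P z) -> \forall n \near \oo, P (x n).
Proof. by move=> hx hP; apply: hx. Qed.

Lemma cpsum_drop e : forall a, geom_bounded a -> (forall m, (m < e)%N -> a m = 0) ->
  \forall z \near (0 : C), cpsum a z = z ^+ e * cpsum (fun n => a (n + e)%N) z.
Proof.
elim: e => [|e IH] a ca a0.
  apply: (@filterE _ (nbhs (0 : C))) => z; rewrite expr0 mul1r.
  by congr cpsum; apply/funext => n; rewrite addn0.
have /IH : forall m, (m < e)%N -> (fun n => a n.+1) m = 0 by move=> m hm; apply: a0.
move=> /(_ (geom_bounded_tail ca)) h; apply: filterS2 (cpsum_tail ca) h => z -> ->.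
rewrite a0 // add0r mulrA -exprS; congr (_ * cpsum _ _).
by apply/funext => n; rewrite addnS.
Qed.

Lemma geom_bounded_drop e (a : nat -> C) : geom_bounded a -> geom_bounded (fun n => a (n + e)%N).
Proof.
move=> ca; elim: e => [|e IH]; first by under eq_fun do rewrite addn0.
by under eq_fun do rewrite addnS -addSn; exact: (geom_bounded_tail IH).
Qed.

Section LogSeries.
Variables (l0 : C) (N J : nat) (H : 'I_J -> nat -> C).
Hypotheses (N0 : (0 < N)%N) (cH : forall j, geom_bounded (H j)).
Let l (n : nat) : C := l0 - (N * n)%:R.
Let X (n : nat) : C := (expR (- n%:R))%:C.
Hypothesis sum0 : \forall n \near \oo,
  \sum_(j < J) l n ^+ j * cpsum (H j) (X n) = 0.

Lemma log_values_large : (fun n => (l n)^-1) @ \oo --> (0 : C).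
Proof.
apply/(cvgCP (F := \oo)) => e e0; apply: filterS (nbhs_infty_gtr (e^-1 + normc l0)) => n hn.
rewrite subr0 Normc.normcV.
have h : e^-1 < normc (l n).
  have : normc ((N * n)%:R : R[i]) <= normc (l n) + normc l0.
    have -> : ((N * n)%:R : R[i]) = l0 - l n by rewrite /l; ring.
    by apply: le_trans (le_normcD _ _) _; rewrite normcN addrC.
  rewrite normc_nat => h; rewrite -(ltrD2r (normc l0)); apply: lt_le_trans h.
  by apply: lt_le_trans hn _; rewrite ler_nat leq_pmull.
by rewrite invf_plt ?posrE //; apply: le_lt_trans h; rewrite invr_ge0 ltW.
Qed.

Lemma log_values_neq0 : \forall n \near \oo, l n != 0.
Proof.
apply: filterS (nbhs_infty_gtr (normc l0)) => n hn; rewrite subr_eq0.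
apply: contraTneq hn => ->; rewrite normc_nat -leNgt ler_nat leq_pmull //.
Qed.

Lemma log_values_le n : normc (l n) <= (normc l0 + N%:R) * n.+1%:R.
Proof.
apply: le_trans (le_normcD _ _) _; rewrite normcN normc_nat mulrDl.
apply: lerD; first by rewrite ler_peMr ?normc_ge0 // ler1n.
by rewrite -natrM ler_nat leq_mul2l leqnSn orbT.
Qed.

(** Induction on the index e.  When all coefficients of index below e
    vanish, dividing the relation by x^e at x = exp(-n) leaves
    sum_j l^j H_j(e) + O(x l^J), where l has the size of n.  The polynomial with
    coefficients H_j(e) therefore tends to 0 while its argument tends to infinity,
    so it is zero. *)
Lemma log_series_indep e j : H j e = 0.
Proof.
elim/ltn_ind: e j => e IH.
(* \poly indexes coefficients by nat, so they are extended by 0 beyond J. *)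
pose F i := if insub i is Some j then H j e else 0.
have FE j : F (val j) = H j e by rewrite /F valK.
suff Q0 : \poly_(i < J) F i = 0.
  by move=> j; have := congr1 (fun p : {poly _} => p`_j) Q0; rewrite coef_poly ltn_ord FE coef0.
apply: (poly_tends0 log_values_large log_values_neq0).
have /choice[M hM] : forall j, exists M : R, \forall z \near (0 : C),
    normc (cpsum (fun n => H j (n.+1 + e)%N) z) <= M.
  by move=> j; apply: cpsum_bounded; exact: (geom_bounded_tail (geom_bounded_drop e (cH j))).
have /filter_forall nM := fun j => near0_seq expRN_tends0 (hM j).
have /filter_forall nd := fun j => near0_seq expRN_tends0
  (cpsum_drop (cH j) (fun m hm => IH m hm j)).
have /filter_forall nt := fun j => near0_seq expRN_tends0 (cpsum_tail (geom_bounded_drop e (cH j))).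
pose A := normc l0 + N%:R.
pose D := \sum_(j < J) A ^+ j * `|M j| * (j.+1%:R ^+ j.+1 * expR 1).
have A0 : 0 <= A by rewrite addr_ge0 ?normc_ge0.
have D0 : 0 <= D.
  apply: sumr_ge0 => j _; rewrite !mulr_ge0 ?exprn_ge0 ?expR_ge0 //.
apply/(cvgCP (F := \oo)) => eps e0.
apply: filterS2 (filterI nM nd) (filterI nt (filterI sum0 (nbhs_infty_gtr (D / eps)))).
move=> n [{}nM {}nd] [{}nt [s0 hn]]; rewrite subr0.
have X0 : X n != 0 by rewrite -normc_gt0 normc_real normr_gt0 gt_eqF ?expR_gt0.
have hQ : (\poly_(i < J) F i).[l n] =
   - (X n * \sum_(j < J) l n ^+ j * cpsum (fun k => H j (k.+1 + e)%N) (X n)).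
  apply/eqP; rewrite -addr_eq0 horner_poly mulr_sumr -big_split /=.
  rewrite -(mulrI_eq0 _ (mulfI (expf_neq0 e X0))) mulr_sumr -{2}s0; apply/eqP.
  apply: eq_bigr => j _; rewrite FE nd -/(X n) nt -/(X n) add0n; ring.
have lt : D / n.+1%:R < eps.
  rewrite ltr_pdivrMr // mulrC -ltr_pdivrMr //; apply: lt_trans hn _.
  by rewrite ltr_nat.
apply: le_lt_trans lt; rewrite hQ normcN Normc.normcM /X normc_real ger0_norm ?expR_ge0 //.
apply: le_trans (_ : expR (- n%:R) * (\sum_(j < J) (A * n.+1%:R) ^+ j * `|M j|) <= _).
  apply: ler_wpM2l; first exact: expR_ge0.
  elim/big_ind2: _ => [|a b c d h1 h2|j _]; first by rewrite Normc.normc0.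
    by apply: le_trans (le_normcD _ _) _; exact: lerD.
  rewrite Normc.normcM normcX; apply: ler_pM; rewrite ?exprn_ge0 ?normc_ge0 //.
    by apply: lerXn2r; rewrite ?nnegrE ?normc_ge0 ?mulr_ge0 // log_values_le.
  by apply: le_trans (nM j) (ler_norm _).
rewrite mulr_sumr mulr_suml; apply: ler_sum => j _.
rewrite exprMn; have := expR_decay j n; set a := _ ^+ j * _; set b := _ / n.+1%:R => ab.
have -> : expR (- n%:R) * (A ^+ j * n.+1%:R ^+ j * `|M j|) = A ^+ j * `|M j| * a.
  by rewrite /a; ring.
by rewrite -[leRHS]mulrA -/b; apply: ler_wpM2l => //; rewrite mulr_ge0 ?exprn_ge0.
Qed.

End LogSeries.

Lemma cvg_fsum I (r : seq I) (f : I -> nat -> C) (l : I -> C) :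
  (forall i, f i @ \oo --> l i) ->
  (fun n => \sum_(i <- r) f i n) @ \oo --> (\sum_(i <- r) l i : C).
Proof.
move=> h; elim: r => [|i r IH].
  rewrite big_nil (_ : (fun _ => _) = fun=> 0); first exact: cvg_cst.
  by apply/funext => n; rewrite big_nil.
rewrite big_cons (_ : (fun _ => _) = fun n => f i n + \sum_(i <- r) f i n).
  by apply: (@cvgD _ _ _ \oo); [exact: h | exact: IH].
by apply/funext => n; rewrite big_cons.
Qed.

Section Interleave.
Variables (N : nat) (N0 : (0 < N)%N) (g : 'I_N -> nat -> C).
Hypothesis cg : forall q, geom_bounded (g q).

(** Coefficients of the series sum_q x^q g_q(x^N) in the variable x. *)
Definition interleave (e : nat) : C := g (Ordinal (ltn_pmod e N0)) (e %/ N).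

Lemma interleaveE (q : 'I_N) m : interleave (m * N + q) = g q m.
Proof.
rewrite /interleave divnMDl // divn_small // addn0; congr (g _ _).
by apply: val_inj; rewrite /= modnMDl modn_small.
Qed.

Lemma geom_bounded_interleave : geom_bounded interleave.
Proof.
have /choice[B hB] : forall q, exists B : R, 0 < B /\ forall n, normc (g q n) <= B ^+ n.+1.
  by move=> q; case: (cg q) => B B0 h; exists B.
pose S := 1 + \sum_q B q.
have S1 : 1 <= S by rewrite lerDl sumr_ge0 // => q _; rewrite ltW //; case: (hB q).
exists S => [|n]; first exact: lt_le_trans S1.
rewrite /interleave; set q := Ordinal _; have [B0 hq] := hB q.
apply: le_trans (hq _) _; apply: le_trans (_ : S ^+ (n %/ N).+1 <= _).
  apply: lerXn2r; rewrite ?nnegrE ?(ltW B0) ?(le_trans ler01 S1) //.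
  rewrite /S (bigD1 q) //= addrCA lerDl addr_ge0 // sumr_ge0 // => q' _.
  by rewrite ltW //; case: (hB q').
by apply: ler_weXn2l => //; rewrite ltnS leq_div.
Qed.

Lemma cpsum_interleave : \forall z \near (0 : C),
  cpsum interleave z = \sum_(q < N) z ^+ q * cpsum (g q) (z ^+ N).
Proof.
have nX (P : C -> Prop) : (\forall z \near (0 : C), P z) ->
    \forall z \near (0 : C), P (z ^+ N).
  case/nbhsCP => e e0 h; apply/nbhsCP; exists (Num.min e 1); first by rewrite lt_min e0 ltr01.
  move=> y; rewrite subr0 lt_min => /andP[y1 y2]; apply: h; rewrite subr0 normcX.
  apply: le_lt_trans y1; rewrite -(prednK N0) exprS ler_piMr ?normc_ge0 //.
  by rewrite exprn_ile1 ?normc_ge0 // ltW.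
have /filter_forall h := fun q => nX _ (cpsum_cvg (cg q)).
apply: filterS2 h (cpsum_cvg geom_bounded_interleave) => z h hi.
have h2 := cvg_comp _ _ (cvg_mulnr _ N0) hi.
rewrite -(limn_unique h2); apply: limn_unique.
rewrite (_ : _ \o _ = fun m => \sum_(q < N) z ^+ q * series (fun n => g q n * (z ^+ N) ^+ n) m).
  apply: cvg_fsum => q.
  by apply: (@cvgM _ _ \oo); [exact: cvg_cst | exact: h].
apply/funext; elim => [|m IH].
  rewrite /= mul0n /series /= big_geq // big1 // => q _.
  by rewrite big_geq // mulr0.
rewrite /= /series /= (big_cat_nat (n := (m * N)%N)) //=; last by rewrite leq_mul2r leqnSn orbT.
move: IH; rewrite /= /series /= => ->.
under [in RHS]eq_bigr => q _ do rewrite big_nat_recr //= mulrDr.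
rewrite big_split /=; congr (_ + _).
rewrite -{1}[(m * N)%N]add0n big_addn mulSn addnK big_mkord.
apply: eq_bigr => q _; rewrite addnC interleaveE -exprM exprD; rewrite [(N * m)%N]mulnC; ring.
Qed.

End Interleave.

Lemma cexp_real (s : R) : cexp (s%:C : C) = (expR s)%:C.
Proof.
by rewrite /cexp /= cos0 sin0 (_ : 1 +i* 0 = 1 :> R[i]) // mulr1.
Qed.

Lemma cexp_natM (n : nat) (z : C) : cexp (n%:R * z : C) = cexp z ^+ n.
Proof.
elim: n => [|n IH]; first by rewrite mul0r cexp0.
by rewrite -natr1 mulrDl mul1r cexpD IH exprSr.
Qed.

Lemma near_slit_seq (u : C) (P : C -> Prop) (x : nat -> C) :
  x @ \oo --> (0 : C) -> (forall n, slit_plane u (x n)) ->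
  (\forall z \near within (slit_plane u) (nbhs (0 : C)), P z) ->
  \forall n \near \oo, P (x n).
Proof.
move=> hx hu hP; have := @near0_seq (fun z => slit_plane u z -> P z) x hx hP.
by apply: filterS => n hn; exact: hn (hu n).
Qed.

Lemma cpsum_scale (a : nat -> C) (v w : C) :
  cpsum (fun m => v ^+ m * a m) w = cpsum a (w * v).
Proof.
rewrite /cpsum (_ : (fun n => _) = fun n => a n * (w * v) ^+ n : C) //.
by apply/funext => m; rewrite exprMn; ring.
Qed.

(** The relation is sampled at z = exp(- N n) (- u), where
    L z = L (- u) - N n by [log_on_ray].  In terms of x = exp(- n), the power
    z^(q/N) is x^q up to a constant, and the N series attached to one power of the
    logarithm interleave into one series in x: the exponents q/N are distinct
    modulo 1, so no two coefficients meet.  The claim is then [log_series_indep]. *)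
Lemma nilsson_indep (u : C) (L : C -> C) (N J : nat) (g : 'I_N -> 'I_J -> nat -> C) :
  u != 0 -> log_determination u L -> (forall q j, geom_bounded (g q j)) ->
  (\forall z \near within (slit_plane u) (nbhs (0 : C)),
     \sum_(q < N) \sum_(j < J)
       cexp (q%:R / N%:R * L z : C) * L z ^+ j * cpsum (g q j) z = 0) ->
  forall q j n, g q j n = 0.
Proof.
move=> u0 hL cg hz q0 j0 n0.
have N0 : (0 < N)%N by apply: leq_ltn_trans (ltn_ord q0).
pose k (q : 'I_N) : C := cexp (q%:R / N%:R * L (- u) : C).
pose h (j : 'I_J) (q : 'I_N) m : C := k q * ((- u) ^+ m * g q j m).
have cg' j q : geom_bounded (fun m => (- u) ^+ m * g q j m).
  apply: (@geom_boundedM _ (1 + normc u)) => //.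
    by rewrite ltr_pwDl // normc_ge0.
  move=> n; rewrite normcX normcN; apply: le_trans (_ : (1 + normc u) ^+ n <= _).
    by apply: lerXn2r; rewrite ?nnegrE ?addr_ge0 ?normc_ge0 // lerDr.
  by apply: ler_weXn2l => //; rewrite lerDl normc_ge0.
have ch j q : geom_bounded (h j q) by exact: geom_boundedZ.
pose X n : C := (expR (- n%:R))%:C.
pose Z n : C := X n ^+ N * - u.
have ZE n : Z n = (expR (- (N * n)%:R))%:C * - u.
  have -> : - (N * n)%:R = N%:R * - n%:R :> R by rewrite natrM mulrN.
  by rewrite expRM_natl rmorphXn.
have Zslit n : slit_plane u (Z n) by rewrite ZE; apply: slit_opp => //; exact: expR_gt0.
have W0 : (fun n => X n ^+ N) @ \oo --> (0 : C).
  have -> : (0 : C) = 0 ^+ N by rewrite expr0n eqn0Ngt N0.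
  elim: (N) => [|m IH]; first exact: cvg_cst.
  rewrite exprS; under eq_fun do rewrite exprS.
  by apply: (@cvgM _ _ \oo); [exact: expRN_tends0 | exact: IH].
have Z0 : Z @ \oo --> (0 : C).
  have -> : (0 : C) = 0 * - u by rewrite mul0r.
  by apply: (@cvgM _ _ \oo); [exact: W0 | exact: cvg_cst].
have LZ n : L (Z n) = L (- u) - (N * n)%:R.
  by rewrite ZE (log_on_ray u0 hL) // rmorph_nat.
have sumX : \forall n \near \oo,
    \sum_(j < J) (L (- u) - (N * n)%:R) ^+ j * cpsum (interleave N0 (h j)) (X n) = 0.
  have /filter_forall hi := fun j => near0_seq expRN_tends0 (cpsum_interleave N0 (ch j)).
  have /filter_forall hk : forall j, \forall n \near \oo, forall q,
      cpsum (h j q) (X n ^+ N) = k q * cpsum (fun m => (- u) ^+ m * g q j m) (X n ^+ N).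
    by move=> j; apply: filter_forall => q; apply: (near0_seq W0 (cpsumZ (k q) (cg' j q))).
  apply: filterS2 (filterI hi hk) (near_slit_seq Z0 Zslit hz) => n [{}hi {}hk] e0.
  rewrite -[RHS]e0 exchange_big /=; apply: eq_bigr => j _; rewrite hi mulr_sumr.
  apply: eq_bigr => q _; rewrite LZ -/(X n).
  have -> : cexp (q%:R / N%:R * (L (- u) - (N * n)%:R) : C) = k q * X n ^+ q.
    rewrite (_ : _ * _ = q%:R / N%:R * L (- u) + q%:R * (- n%:R : R)%:C); last first.
      rewrite rmorphN /= rmorph_nat natrM; field.
      by rewrite pnatr_eq0 -lt0n.
    by rewrite cexpD cexp_natM cexp_real.
  have -> : cpsum (h j q) (X n ^+ N) = k q * cpsum (g q j) (Z n).
    by rewrite hk cpsum_scale.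
  by ring.
have := log_series_indep N0 (fun j => geom_bounded_interleave N0 (ch j)) sumX (n0 * N + q0) j0.
rewrite interleaveE /h => /eqP; rewrite mulf_eq0 => /orP[/eqP k0|].
  by case/eqP: (cexp_neq0 (q0%:R / N%:R * L (- u))).
by rewrite mulf_eq0 expf_eq0 oppr_eq0 (negPf u0) andbF => /eqP.
Qed.

End Indep.

(** * Linear functionals over a subfield *)

Section LinAlg.
Variables (K F : fieldType) (iota : {rmorphism K -> F}).

Definition indep r (mu : 'I_r -> F) : Prop :=
  forall c : 'I_r -> K, \sum_i iota (c i) * mu i = 0 -> forall i, c i = 0.

Lemma indep_spanning (s : seq F) : exists (r : nat) (mu : 'I_r -> F), indep mu /\
  forall x, x \in s -> exists c : 'I_r -> K, x = \sum_i iota (c i) * mu i.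
Proof.
elim: s => [|x s [r [mu [imu hs]]]].
  by exists 0, (fun=> 0); split=> [c _ []|].
have [[c cx]|nx] := pselect (exists c : 'I_r -> K, x = \sum_i iota (c i) * mu i).
  exists r, mu; split=> // y; rewrite inE => /orP[/eqP ->|]; last exact: hs.
  by exists c.
pose mu' (i : 'I_r.+1) := oapp mu x (unlift ord0 i).
have sumE (c : 'I_r.+1 -> K) : \sum_i iota (c i) * mu' i =
    iota (c ord0) * x + \sum_i iota (c (lift ord0 i)) * mu i.
  rewrite big_ord_recl /mu' unlift_none; congr (_ + _).
  by apply: eq_bigr => i _; rewrite liftK.
exists r.+1, mu'; split.
  move=> c; rewrite sumE => c0; have c00 : c ord0 = 0.
    apply/eqP/negPn/negP => nc0; apply: nx.
    exists (fun i => - c (lift ord0 i) / c ord0).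
    apply: (mulfI (_ : iota (c ord0) != 0)); first by rewrite fmorph_eq0.
    move/eqP: c0; rewrite addr_eq0 => /eqP ->; rewrite mulr_sumr -sumrN.
    apply: eq_bigr => i _; rewrite rmorphM rmorphN fmorphV.
    by field; rewrite fmorph_eq0.
  move: c0; rewrite c00 rmorph0 mul0r add0r => /imu h i.
  by case: (unliftP ord0 i) => [j ->|->].
move=> y; rewrite inE => /orP[/eqP ->|/hs[c ->]].
  exists (fun i => (i == ord0)%:R); rewrite sumE eqxx rmorph1 mul1r big1 ?addr0 //.
  by move=> i _; rewrite rmorph0 mul0r.
exists (fun i => oapp c 0 (unlift ord0 i)); rewrite sumE unlift_none rmorph0 mul0r add0r.
by apply: eq_bigr => i _; rewrite liftK.
Qed.

Definition subspace (W : set F) : Prop :=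
  [/\ W 0, forall x y, W x -> W y -> W (x + y) & forall a x, W x -> W (iota a * x)].

Definition scalar_functional (phi : F -> K) : Prop :=
  (forall x y, phi (x + y) = phi x + phi y) /\
  (forall a x, phi (iota a * x) = a * phi x).

(** By Zorn's lemma there is a subspace W maximal among those that
    contain W0 and avoid x0.  Maximality puts every vector in W + K x0, and the
    functional is the coordinate along x0. *)
Lemma separating_functional (W0 : set F) (x0 : F) : subspace W0 -> ~ W0 x0 ->
  exists phi : F -> K, [/\ scalar_functional phi, forall x, W0 x -> phi x = 0
    & phi x0 = 1].
Proof.
(* Adding W0 to every set makes the empty chain harmless. *)
move=> sW0 nW0; pose P (A : set F) := subspace (A `|` W0) /\ ~ (A `|` W0) x0.
have [A [[sA nA] maxA]] : exists A, P A /\ forall B, A `<` B -> ~ P B.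
  apply: Zorn_bigcup => Fm FP tot; split; last first.
    by case=> // -[X FX Xx]; have [_] := FP _ FX; apply; left.
  have [z0 add sc] := sW0; split; first by right.
    have inX X x y : Fm X -> X x -> (X `|` W0) y -> (\bigcup_(X in Fm) X `|` W0) (x + y).
      move=> FX Xx Xy; have [[_ addX _] _] := FP _ FX.
      by have [?|?] := addX _ _ (or_introl Xx) Xy; [left; exists X | right].
    move=> x y [[X FX Xx]|Wx] [[Y FY Yy]|Wy]; last by right; apply: add.
    - have [XY|YX] := tot _ _ FX FY.
        by apply: (inX Y) => //; [exact: XY | left].
      by apply: (inX X) => //; left; exact: YX.
    - by apply: (inX X) => //; right.
    - by rewrite addrC; apply: (inX Y) => //; right.
  move=> a x [[X FX Xx]|Wx]; last by right; apply: sc.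
  have [[_ _ scX] _] := FP _ FX.
  by have [?|?] := scX a _ (or_introl Xx); [left; exists X | right].
(* Every x outside W puts x0 in W + K x, which is solved for x. *)
set W := A `|` W0 in sA nA; have [W00 addW scW] := sA.
have decomp x : exists k, W (x - iota k * x0).
  have [Wx|nWx] := pselect (W x); first by exists 0; rewrite rmorph0 mul0r subr0.
  pose B := [set y | exists2 w, W w & exists a, y = w + iota a * x].
  have BW0 : B `|` W0 = B.
    apply/seteqP; split=> [y [//|Wy]|y By]; last by left.
    by exists y; [right | exists 0; rewrite rmorph0 mul0r addr0].
  have AB : A `<` B.
    split=> [|BA]; last first.
      apply: nWx; left; apply: BA; exists 0 => //.
      by exists 1; rewrite rmorph1 mul1r add0r.
    by move=> y Ay; exists y; [left | exists 0; rewrite rmorph0 mul0r addr0].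
  have /not_andP[nsB|/contrapT] := maxA _ AB.
    case: nsB; rewrite BW0; split.
    - by exists 0 => //; exists 0; rewrite rmorph0 mul0r addr0.
    - move=> y z [w Ww [a ->]] [w' Ww' [a' ->]]; exists (w + w'); first exact: addW.
      by exists (a + a'); rewrite rmorphD; ring.
    - move=> b y [w Ww [a ->]]; exists (iota b * w); first exact: scW.
      by exists (b * a); rewrite rmorphM; ring.
  rewrite BW0 => -[w Ww [a x0E]].
  have a0 : a != 0.
    by apply: contra_notN nA => /eqP a0; rewrite x0E a0 rmorph0 mul0r addr0.
  exists a^-1; rewrite x0E (_ : _ - _ = iota (- a^-1) * w); first exact: scW.
  by rewrite rmorphN fmorphV; field; rewrite fmorph_eq0.
have /choice[phi hphi] := decomp.
have uniq_k x k : W (x - iota k * x0) -> phi x = k.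
  move=> hk; apply/eqP; rewrite -subr_eq0; apply/negPn/negP => h.
  apply: nA; have := addW _ _ hk (scW (-1) _ (hphi x)).
  rewrite (_ : _ + _ = iota (phi x - k) * x0); last first.
    by rewrite rmorphN rmorph1 rmorphB; ring.
  move=> /(scW (phi x - k)^-1); rewrite mulrA -rmorphM mulVf // rmorph1 mul1r //.
exists phi; split; first split.
- move=> x y; apply: uniq_k; have := addW _ _ (hphi x) (hphi y).
  by congr W; rewrite rmorphD; ring.
- move=> a x; apply: uniq_k; have := scW a _ (hphi x).
  by congr W; rewrite rmorphM; ring.
- by move=> x Wx; apply: uniq_k; rewrite rmorph0 mul0r subr0; right.
- by apply: uniq_k; rewrite rmorph1 mul1r subrr.
Qed.

(** The vector mu t lies outside the span of the other members of the
    family. *)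
Lemma dual_functional r (mu : 'I_r -> F) (t : 'I_r) : indep mu ->
  exists2 phi : F -> K, scalar_functional phi & forall s, phi (mu s) = (s == t)%:R.
Proof.
move=> imu; pose W0 := [set x | exists2 c : 'I_r -> K, c t = 0 & x = \sum_i iota (c i) * mu i].
have sW0 : subspace W0.
  split; first by exists (fun=> 0) => //; rewrite big1 // => i _; rewrite rmorph0 mul0r.
    move=> x y [c c0 ->] [d d0 ->]; exists (fun i => c i + d i); first by rewrite c0 d0 addr0.
    by rewrite -big_split; apply: eq_bigr => i _; rewrite rmorphD mulrDl.
  move=> a x [c c0 ->]; exists (fun i => a * c i); first by rewrite c0 mulr0.
  by rewrite mulr_sumr; apply: eq_bigr => i _; rewrite rmorphM mulrA.
have nW0 : ~ W0 (mu t).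
  case=> c c0 ct; have := imu (fun i => c i - (i == t)%:R).
  rewrite (_ : \sum_i _ = 0) => [/(_ erefl t)/eqP|].
    by rewrite c0 eqxx sub0r oppr_eq0 oner_eq0.
  under eq_bigr => i _ do rewrite rmorphB mulrBl.
  rewrite sumrB -ct (bigD1 t) //= eqxx rmorph1 mul1r big1 ?addr0 ?subrr // => i /negPf ->.
  by rewrite rmorph0 mul0r.
have [phi [lin phi0 phi1]] := separating_functional sW0 nW0.
exists phi => // s; have [->//|st] := eqVneq s t; apply: phi0.
exists (fun i => (i == s)%:R); first by rewrite eq_sym (negPf st).
rewrite (bigD1 s) //= eqxx rmorph1 mul1r big1 ?addr0 // => i /negPf ->.
by rewrite rmorph0 mul0r.
Qed.

End LinAlg.

(** * Closure properties of arithmetic growth *)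

Section Arith.
Variables (R : realType) (iota : {rmorphism algC -> R[i]}).
Local Notation C := (R[i]^o).
Local Notation normc := Normc.normc.
Local Notation ag := (arith_growth iota).

Lemma psumE (a : nat -> algC) : psum iota a = cpsum (fun n => iota (a n) : C).
Proof. by []. Qed.

Lemma arith_growth_geom_bounded a : ag a -> geom_bounded (fun n => iota (a n) : C).
Proof.
case=> B B0 [h _]; exists B => // n.
have := h idfun n; rewrite cnormE lecR; apply; exact: (Bijective (g := id)).
Qed.

(** All conjugates of c are roots of its minimal polynomial. *)
Lemma conj_bounded (c : algC) : exists2 M : R, 0 < M &
  forall sigma : {rmorphism algC -> algC}, normc (iota (sigma c)) <= M.
Proof.
have [r Dr] := closed_field_poly_normal (minCpoly c).
have nn (z : algC) : 0 <= normc (iota z) by exact: normc_ge0.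
exists (1 + \sum_(z <- r) normc (iota z)).
  by rewrite ltr_pwDl // sumr_ge0.
move=> sigma; have rs : sigma c \in r.
  have : root (minCpoly c) (sigma c) by rewrite -(minCpoly_aut sigma) root_minCpoly.
  by rewrite Dr (monicP (minCpoly_monic c)) scale1r root_prod_XsubC.
rewrite (big_rem _ rs) /= addrCA lerDl addr_ge0 // sumr_ge0 //.
Qed.

(** If q is an integral polynomial of degree n and leading coefficient a that
    vanishes at c, then a^(n-1) q(c) is the value at a c of a monic integral
    polynomial. *)
Lemma Aint_scaled (c : algC) : exists2 m : nat, (0 < m)%N & m%:R * c \in Aint.
Proof.
have [p [Dp mon_p] _] := minCpolyP c; have := root_minCpoly c; rewrite Dp.
have [q [b b0 pE]] := rat_poly_scale p => rc.
have q0 : q != 0.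
  by apply: contraTneq mon_p => q0; rewrite pE q0 rmorph0 scaler0 monicE lead_coef0.
have {}rc : (map_poly intr q : {poly algC}).[c] = 0.
  apply/eqP; move: rc; rewrite pE map_polyZ rootZ; last first.
    by rewrite fmorph_eq0 invr_eq0 intr_eq0.
  by rewrite -map_poly_comp /root; congr (_.[_] == _); apply: eq_map_poly => z /=; rewrite ratr_int.
pose a := lead_coef q; pose n := (size q).-1.
have sq : size q = n.+1 by rewrite /n prednK // size_poly_gt0.
have a0 : a != 0 by rewrite lead_coef_eq0.
pose s : {poly algC} := 'X^n + \poly_(i < n) ((q`_i * a ^+ (n.-1 - i))%:~R).
have szp : (size (\poly_(i < n) ((q`_i * a ^+ (n.-1 - i))%:~R : algC)) <= n)%N by exact: size_poly.
have ac : a%:~R * c \in Aint.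
  apply: (@root_monic_Aint s).
  - have n0 : (0 < n)%N.
      rewrite lt0n; apply/eqP => n0; move: rc; rewrite horner_coef size_map_inj_poly //; last exact: intr_inj.
      rewrite sq n0 big_ord1 expr0 mulr1 coef_map /= => /eqP; rewrite intr_eq0.
      have -> : q`_0 = a by rewrite /a lead_coefE -/n n0.
      by rewrite (negPf a0).
    rewrite /root /s hornerD hornerXn horner_poly exprMn.
    suff -> : \sum_(i < n) (q`_i * a ^+ (n.-1 - i))%:~R * (a%:~R * c) ^+ i =
        (a%:~R) ^+ n.-1 * \sum_(i < n) (q`_i)%:~R * c ^+ i.
      have -> : (a%:~R : algC) ^+ n * c ^+ n = a%:~R ^+ n.-1 * (a%:~R * c ^+ n).
        by rewrite mulrA -exprSr prednK.
      rewrite -mulrDr mulf_eq0; apply/orP; right; move/eqP: rc; rewrite addrC horner_coef.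
      rewrite size_map_inj_poly //; last exact: intr_inj.
      rewrite sq big_ord_recr /= coef_map /=.
      have -> : q`_n = a by rewrite /a lead_coefE.
      by congr (_ + _ == 0); apply: eq_bigr => i _; rewrite coef_map.
    rewrite mulr_sumr; apply: eq_bigr => i _.
    have -> : (a%:~R : algC) ^+ n.-1 = a%:~R ^+ (n.-1 - i) * a%:~R ^+ i.
      by rewrite -exprD subnK // -ltnS prednK.
    by rewrite rmorphM rmorphXn exprMn /=; ring.
  - rewrite monicE /s lead_coefDl ?lead_coefXn // size_polyXn ltnS //.
  - apply/polyOverP => i; rewrite coefD coefXn coef_poly; apply: rpredD.
      exact: natr_int.
    by case: ifP => _; rewrite ?rpred0 // intr_int.
exists `|a|%N; first by rewrite absz_gt0.
have -> : (`|a|%N%:R : algC) = `|a|%:~R by rewrite -abszE.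
by case: (intP a) ac => [|k|k] //; rewrite ?normr0 // ?normrN // rmorphN mulNr rpredN.
Qed.

Lemma exp_monotone (B B' : R) : 0 < B -> B <= B' ->
  forall n, B ^+ n.+1 <= B' ^+ n.+1.
Proof.
by move=> B0 BB n; apply: lerXn2r; rewrite ?nnegrE ?(ltW B0) // (le_trans (ltW B0)).
Qed.

Lemma arith_growthD a b : ag a -> ag b -> ag (fun n => a n + b n).
Proof.
move=> [A A0 [ha [d hd]]] [B B0 [hb [e he]]].
have AB0 : 0 < A * B by rewrite mulr_gt0.
exists (A + B + A * B); first by rewrite !addr_gt0.
split=> [sigma n bij|].
  have := ha sigma n bij; have := hb sigma n bij; rewrite !cnormE !lecR => h1 h2.
  rewrite !rmorphD /=; apply: le_trans (le_normcD _ _) _.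
  apply: le_trans (lerD h2 h1) _; apply: le_trans (expr_sum_le _ (ltW A0) (ltW B0)) _.
  by apply: exp_monotone => //; [rewrite addr_gt0 | rewrite lerDl ltW].
exists (fun n => d n * e n)%N => n; have [d0 dA da] := hd n; have [e0 eB eb] := he n.
split; first by rewrite muln_gt0 d0.
  rewrite natrM; apply: le_trans (_ : (A * B) ^+ n.+1 <= _).
    by rewrite exprMn; apply: ler_pM.
  by apply: exp_monotone => //; rewrite lerDr addr_ge0 // ltW.
move=> m mn; rewrite mulrDr rpredD // natrM.
  by rewrite mulrAC rpredM ?da // Aint_Cnat.
by rewrite -mulrA rpredM ?eb // Aint_Cnat.
Qed.

Lemma arith_growthZ c a : ag a -> ag (fun n => c * a n).
Proof.
move=> [A A0 [ha [d hd]]]; have [M M0 hM] := conj_bounded c.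
have [m m0 mc] := Aint_scaled c.
have k0 (k : R) : 0 <= k -> forall n, k <= (1 + k) ^+ n.+1.
  move=> k0 n; apply: le_trans (_ : (1 + k) ^+ 1 <= _); first by rewrite expr1 lerDr.
  by apply: ler_weXn2l => //; rewrite lerDl.
pose B := (1 + M) * A + (1 + m%:R) * A.
have B1 : 0 < (1 + M) * A by rewrite mulr_gt0 // addr_gt0.
have B2 : 0 < (1 + m%:R) * A by rewrite mulr_gt0 // ltr_pwDl.
exists B; first by rewrite addr_gt0.
split=> [sigma n bij|].
  have := ha sigma n bij; rewrite !cnormE !lecR => h1.
  rewrite !rmorphM Normc.normcM; apply: le_trans (_ : ((1 + M) * A) ^+ n.+1 <= _).
    rewrite exprMn; apply: ler_pM; rewrite ?normc_ge0 //.
    by apply: le_trans (hM _) _; apply: k0; exact: ltW.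
  by apply: exp_monotone => //; rewrite lerDl ltW.
exists (fun n => m * d n)%N => n; have [d0 dA da] := hd n.
split; first by rewrite muln_gt0 m0.
  rewrite natrM; apply: le_trans (_ : ((1 + m%:R) * A) ^+ n.+1 <= _).
    by rewrite exprMn; apply: ler_pM => //; apply: k0.
  by apply: exp_monotone => //; rewrite lerDr ltW.
by move=> k kn; rewrite natrM mulrACA rpredM // da.
Qed.

Lemma arith_growth_shift a : ag a -> ag (seq_shift a).
Proof.
move=> [A A0 [ha [d hd]]]; have B0 : 0 < 1 + A by rewrite addr_gt0.
have up n : A ^+ n.+1 <= (1 + A) ^+ n.+1 by apply: exp_monotone => //; rewrite lerDr.
exists (1 + A) => //; split=> [sigma [|n] bij|].
- by rewrite /seq_shift !rmorph0 normr0 ler0c exprn_ge0 // ltW.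
- rewrite /seq_shift; apply: le_trans (ha _ _ bij) _; rewrite lecR.
  apply: le_trans (up n) _; apply: ler_weXn2l => //; by rewrite lerDl ltW.
exists d => n; have [d0 dA da] := hd n; split=> //; first exact: le_trans dA (up n).
case=> [|m] mn; first by rewrite mulr0 rpred0.
by apply: da; exact: ltnW.
Qed.

Lemma arith_growth0 : ag (fun=> 0).
Proof.
exists 1 => //; split=> [sigma n _|].
  by rewrite !rmorph0 normr0 ler0c exprn_ge0.
exists (fun=> 1%N) => n; rewrite expr1n; split=> // m _.
by rewrite mulr0 rpred0.
Qed.

Lemma arith_growth_sum I (r : seq I) (a : I -> nat -> algC) : (forall i, ag (a i)) ->
  ag (fun n => \sum_(i <- r) a i n).
Proof.
move=> h; elim: r => [|i r IH].
  by under eq_fun do rewrite big_nil; exact: arith_growth0.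
by under eq_fun do rewrite big_cons; exact: arith_growthD.
Qed.

End Arith.

(** * Differential equations and finite differential systems *)

Section ODE.
Variables (R : realType) (K : fieldType) (phi : {rmorphism K -> R[i]}).
Local Notation C := (R[i]^o).
Local Notation normc := Normc.normc.

Definition ev (p : {poly K}) (z : C) : C := (map_poly phi p).[z].

Lemma evD p q z : ev (p + q) z = ev p z + ev q z.
Proof. by rewrite /ev rmorphD hornerD. Qed.
Lemma evM p q z : ev (p * q) z = ev p z * ev q z.
Proof. by rewrite /ev rmorphM hornerM. Qed.
Lemma ev0 z : ev 0 z = 0.
Proof. by rewrite /ev rmorph0 horner0. Qed.
Lemma ev1 z : ev 1 z = 1.
Proof. by rewrite /ev rmorph1 hornerC. Qed.
Lemma evN p z : ev (- p) z = - ev p z.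
Proof. by rewrite /ev rmorphN hornerN. Qed.
Lemma evC c z : ev c%:P z = phi c.
Proof. by rewrite /ev map_polyC hornerC. Qed.
Lemma evX z : ev 'X z = z.
Proof. by rewrite /ev map_polyX hornerX. Qed.
Lemma ev_exp p n z : ev (p ^+ n) z = ev p z ^+ n.
Proof. by rewrite /ev rmorphXn horner_exp. Qed.
Lemma ev_nat n z : ev n%:R z = n%:R.
Proof. by rewrite /ev rmorph_nat -polyC_natr hornerC. Qed.
Lemma ev_sum I (r : seq I) P (p : I -> {poly K}) z :
  ev (\sum_(i <- r | P i) p i) z = \sum_(i <- r | P i) ev (p i) z.
Proof. by rewrite /ev rmorph_sum horner_sum. Qed.
Lemma ev_prod I (r : seq I) P (p : I -> {poly K}) z :
  ev (\prod_(i <- r | P i) p i) z = \prod_(i <- r | P i) ev (p i) z.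
Proof. by rewrite /ev rmorph_prod horner_prod. Qed.

Lemma cder_ev p z : is_derive z (1 : C) (ev p) (ev p^`() z).
Proof. by rewrite /ev -deriv_map; exact: cder_poly. Qed.

(** Once the power of 'X dividing p is removed, the cofactor does not vanish
    at 0, hence not near 0 either. *)
Lemma ev_near_neq0 p : p != 0 -> \forall z \near (0 : C), z != 0 -> ev p z != 0.
Proof.
move=> p0; have [m [q + pE]] := multiplicity_XsubC p 0.
rewrite p0 subr0 /= in pE * => q0.
have h : ev q (0 : C) != 0.
  by rewrite /ev -(rmorph0 phi) horner_map (inj_eq (fmorph_inj phi)).
have k0 : 0 < normc (ev q 0) by rewrite normc_gt0.
have := cder_continuous (cder_ev q 0) => /(cvgCP (F := nbhs (0 : C))) /(_ _ k0).
apply: filterS => z hz z0; rewrite pE evM ev_exp evX mulf_neq0 ?expf_neq0 //.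
by apply: contraTneq hz => ->; rewrite sub0r normcN ltxx.
Qed.

Section Dom.
Variable D : set C.
Hypotheses (oD : open D) (D0 : forall z, D z -> z != 0).
Local Notation FD := (within D (nbhs (0 : C))).

(** What holds near 0 inside an open set holds in a neighbourhood of each
    nearby point of that set, so such equations can be differentiated. *)
Lemma near_open (P : C -> Prop) : (\forall z \near FD, P z) ->
  \forall z \near FD, D z /\ \forall y \near z, P y.
Proof.
move=> /nbhsCP[e e0 h]; apply/nbhsCP; exists e => // y; rewrite subr0 => ye Dy; split=> //.
have Dn : nbhs y D by move: oD; rewrite openE; apply.
have nP : \forall w \near y, D w -> P w.
  apply/nbhsCP; exists (e - normc y); first by rewrite subr_gt0.
  move=> w hw; apply: (h w); rewrite subr0 -[w](subrK y).
  by apply: le_lt_trans (le_normcD _ _) _; rewrite -ltrBrDr.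
by apply: filterS2 Dn nP => w Dw; apply.
Qed.

Lemma near_FD (P : C -> Prop) : (\forall z \near (0 : C), z != 0 -> P z) ->
  \forall z \near FD, P z.
Proof. by apply: filterS => z h Dz; apply: h; apply: D0. Qed.

Lemma near_FD0 (P : C -> Prop) : (\forall z \near (0 : C), P z) ->
  \forall z \near FD, P z.
Proof. by apply: filterS. Qed.

(** A presentation of F inside a differential module of finite dimension over
    K(z): the family Y spans it, U / e is the matrix of the derivation, and v gives
    the coordinates of F.  Sums and products are easier to form on such systems than
    on scalar equations. *)
Definition diffmod (F : C -> C) : Prop :=
  exists (I : finType) (Y : I -> C -> C) (e : {poly K}) (U : I -> I -> {poly K})
    (v : I -> {poly K}), e != 0 /\
  \forall z \near FD, (forall a, derivable (Y a) z 1 /\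
      ev e z * derive1 (Y a) z = \sum_b ev (U a b) z * Y b z) /\
    F z = \sum_a ev (v a) z * Y a z.

Lemma ratfun_eval_poly (p : {poly K}) : \forall z \near FD,
  ratfun_eval phi (FracField.tofrac p) z = ev p z.
Proof.
set r := repr (FracField.tofrac p).
have rE : (frac r).1 = (frac r).2 * p.
  have := FracField.equivf_l (Ratio p 1); rewrite !numden_Ratio ?oner_neq0 // mulr1.
  by rewrite /r /FracField.tofrac -lock.
have := near_FD (ev_near_neq0 (denom_ratioP r)).
apply: filterS => z hz; rewrite /ratfun_eval -/r rE rmorphM hornerM mulrC mulrA.
by rewrite mulVf ?mul1r //; exact: hz.
Qed.

Lemma derive1_near (f g : C -> C) (z a : C) : (\forall y \near z, f y = g y) ->
  is_derive z (1 : C) g a -> is_derive z (1 : C) f a.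
Proof.
move=> fg [h ha]; have gf : \forall y \near z, g y = f y by apply: filterS fg => y ->.
split; first exact: near_eq_derivable gf h.
by rewrite -(near_eq_derive _ gf).
Qed.

Section System.
Variables (F : C -> C) (I : finType) (Y : I -> C -> C) (e : {poly K}).
Variables (U : I -> I -> {poly K}) (v : I -> {poly K}).
Hypotheses (e0 : e != 0) (sys : \forall z \near FD, (forall a, derivable (Y a) z 1 /\
      ev e z * derive1 (Y a) z = \sum_b ev (U a b) z * Y b z) /\
    F z = \sum_a ev (v a) z * Y a z).

(** Coordinates of e^i F^(i) in the family Y; the subtracted term compensates
    for the derivative of e^i. *)
Fixpoint iterder (i : nat) : I -> {poly K} :=
  if i is k.+1 then fun b => e * (iterder k b)^`() + \sum_a iterder k a * U a b
      - k%:R * e^`() * iterder k b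
  else v.

Lemma iterderP i : \forall z \near FD,
  (forall k, (k < i)%N -> derivable (derive1n k F) z 1) /\
  ev e z ^+ i * derive1n i F z = \sum_a ev (iterder i a) z * Y a z.
Proof.
elim: i => [|i IH].
  by apply: filterS sys => z [_ Fz]; split=> //; rewrite expr0 mul1r.
apply: filterS2 (near_open (filterI sys IH)) (near_open (near_FD (ev_near_neq0 e0))).
move=> z [Dz nz] [_ ne]; have [[sz Fz] [dz rz]] := nbhs_singleton nz.
have ez := nbhs_singleton ne.
pose S y := \sum_a ev (iterder i a) y * Y a y.
pose S' := \sum_a (ev (iterder i a)^`() z * Y a z + ev (iterder i a) z * derive1 (Y a) z).
have dS : is_derive z (1 : C) S S'.
  apply: cder_sum => a; apply: cderM; first exact: cder_ev.
  by apply: derivable_cder; case: (sz a).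
have dE : is_derive z (1 : C) (ev (e ^+ i)) (ev (e ^+ i)^`() z) by exact: cder_ev.
have ei0 : ev (e ^+ i) z != 0 by rewrite ev_exp expf_neq0.
have dF : derivable (derive1n i F) z 1.
  apply: cder_derivable; apply: (derive1_near _ (cderM dS (cderV ei0 dE))).
  apply: filterS2 nz ne => y [_ [_ ry]] ey; rewrite /S -ry ev_exp mulrC mulKf //.
  by rewrite expf_neq0.
split=> [k|]; first by rewrite ltnS leq_eqVlt => /orP[/eqP ->|/dz].
have dP := cderM dE (derivable_cder dF).
have dP' : is_derive z (1 : C) (fun y => ev (e ^+ i) y * derive1n i F y) S'.
  apply: derive1_near dS; apply: filterS nz => y [_ [_ ry]].
  by rewrite /S -ry ev_exp.
have := cder_val dP; rewrite (cder_val dP') => hS.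
have -> : derive1n i.+1 F z = derive1 (derive1n i F) z by [].
have -> : ev e z ^+ i.+1 * derive1 (derive1n i F) z =
    ev e z * S' - i%:R * ev e^`() z * (ev e z ^+ i * derive1n i F z).
  rewrite hS deriv_exp -mulr_natr !evM ev_nat !ev_exp.
  move: (derive1n i F z) (derive1 (derive1n i F) z) (ev e z) (ev e^`() z) => a b c d.
  by case: (i) => [|j]; rewrite /= ?expr0 ?exprS; ring.
rewrite rz /S' !mulr_sumr -sumrB /=.
under [in RHS]eq_bigr => b _ do rewrite evD evN evD !evM ev_nat ev_sum mulrBl mulrDl mulr_suml.
rewrite [in RHS]sumrB [in RHS]big_split /= [in RHS]exchange_big /= -[in RHS]big_split /= -sumrB.
apply: eq_bigr => a _.
have -> : \sum_b ev (iterder i a * U a b) z * Y b z = ev (iterder i a) z * (ev e z * derive1 (Y a) z).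
  by case: (sz a) => _ ->; rewrite mulr_sumr; apply: eq_bigr => b _; rewrite evM mulrA.
by rewrite /=; ring.
Qed.

(** There is one vector more than there are coordinates.  Bordered by a zero
    column these vectors form a square matrix of determinant 0, and over an integral
    domain such a matrix has a nonzero kernel vector: the relation has polynomial
    coefficients. *)
Lemma kernel_exists : exists c : 'I_#|I|.+1 -> {poly K},
  (exists i, c i != 0) /\ forall a, \sum_i c i * iterder i a = 0.
Proof.
pose n := #|I|.
pose M : 'M[{poly K}]_n.+1 := \matrix_(i, j)
  oapp (fun k : 'I_n => iterder i (enum_val k)) 0 (unlift ord_max j).
have /det0P[c c0 cM] : \det M == 0.
  rewrite (expand_det_col _ ord_max) big1 // => i _.
  by rewrite mxE unlift_none mul0r.
exists (fun i => c 0 i); split.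
  by apply/existsP; apply: contraNT c0 => /existsPn h; apply/eqP/rowP => i;
    rewrite mxE; apply/eqP; have := h i; rewrite negbK.
move=> a; have := congr1 (fun A : 'rV_n.+1 => A 0 (lift ord_max (enum_rank a))) cM.
rewrite !mxE => hc; rewrite -[RHS]hc; apply: eq_bigr => i _; congr (_ * _).
by rewrite mxE liftK /= enum_rankK.
Qed.

End System.

Lemma diffmod_ode F : diffmod F -> linear_ode_solution phi D F.
Proof.
move=> [I [Y [e [U [v [e0 sys]]]]]].
have [c [[i0 ci0] cK]] := kernel_exists e U v.
exists #|I|, (fun i => FracField.tofrac (c i * e ^+ i)); split.
  by exists i0; rewrite tofrac_eq0 mulf_neq0 // expf_neq0.
have /filter_forall h1 := fun i : 'I_#|I|.+1 => ratfun_eval_poly (c i * e ^+ i).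
have /filter_forall h2 := fun i : 'I_#|I|.+1 => iterderP e0 sys i.
apply: filterS2 h1 h2 => z {}h1 {}h2; split.
  by move=> i hi; have [h _] := h2 ord_max; exact: h.
under eq_bigr => i _ do rewrite h1 evM ev_exp -mulrA; case: (h2 ord0) => _ _.
rewrite (eq_bigr (fun i : 'I_#|I|.+1 => \sum_a ev (c i * iterder e U v i a) z * Y a z)).
  rewrite exchange_big big1 //= => a _.
  by rewrite -mulr_suml -ev_sum cK ev0 mul0r.
move=> i _; case: (h2 i) => _ ->; rewrite mulr_sumr.
by apply: eq_bigr => a _; rewrite evM mulrA.
Qed.

Lemma diffmodD F G : diffmod F -> diffmod G -> diffmod (fun z => F z + G z).
Proof.
move=> [I [Y [e [U [v [e0 sys]]]]]] [I' [Y' [e' [U' [v' [e0' sys']]]]]].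
exists (I + I')%type, (fun a => match a with inl a => Y a | inr a => Y' a end), (e * e'),
  (fun a b => match a, b with inl a, inl b => e' * U a b | inr a, inr b => e * U' a b
     | _, _ => 0 end), (fun a => match a with inl a => v a | inr a => v' a end).
split; first by rewrite mulf_neq0.
apply: filterS2 sys sys' => z [s ->] [s' ->]; split; last by rewrite big_sumType.
move=> [a|a]; rewrite big_sumType /=.
  have [d sa] := s a; split=> //; rewrite [X in _ + X]big1 ?addr0; last first.
    by move=> b _; rewrite ev0 mul0r.
  rewrite evM -mulrA mulrCA sa mulr_sumr; apply: eq_bigr => b _.
  by rewrite evM mulrA.
have [d sa] := s' a; split=> //; rewrite [X in X + _]big1 ?add0r; last first.
  by move=> b _; rewrite ev0 mul0r.
by rewrite evM -mulrA sa mulr_sumr; apply: eq_bigr => b _; rewrite evM mulrA.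
Qed.

Lemma diffmod0 : diffmod (fun=> 0).
Proof.
exists 'I_0, (fun=> fun=> 0), 1, (fun _ _ => 0), (fun=> 0).
split; first exact: oner_neq0.
by apply: (@filterE _ FD) => z; split=> [[]|] //; rewrite big_ord0.
Qed.

Lemma diffmod_sum J (r : seq J) (F : J -> C -> C) : (forall j, diffmod (F j)) ->
  diffmod (fun z => \sum_(j <- r) F j z).
Proof.
move=> h; elim: r => [|j r IH].
  by under eq_fun do rewrite big_nil; exact: diffmod0.
by under eq_fun do rewrite big_cons; exact: diffmodD.
Qed.

Lemma diffmod_near F G : (\forall z \near FD, F z = G z) -> diffmod F -> diffmod G.
Proof.
move=> FG [I [Y [e [U [v [e0 sys]]]]]]; exists I, Y, e, U, v; split=> //.
by apply: filterS2 FG sys => z <-.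
Qed.

(** Denominators are cleared, and the equation is cut at its last nonzero
    coefficient so that the leading one is nonzero. *)
Lemma ode_poly F : linear_ode_solution phi D F ->
  exists (m : nat) (p : nat -> {poly K}), p m != 0 /\
  \forall z \near FD, (forall i, (i < m)%N -> derivable (derive1n i F) z 1) /\
    \sum_(i < m.+1) ev (p i) z * derive1n i F z = 0.
Proof.
move=> [m [c [[i0 ci0] h]]].
pose num (i : 'I_m.+1) := (frac (repr (c i))).1.
pose den (i : 'I_m.+1) := (frac (repr (c i))).2.
have den0 i : den i != 0 by exact: denom_ratioP.
have num0 i : (num i == 0) = (c i == 0).
  rewrite /num -[in RHS](reprK (c i)) FracField.numer0; congr (_ == _).
  rewrite -tofrac0 /FracField.tofrac -lock; apply/esym/eqP.
  by rewrite -FracField.numer0 numer_Ratio ?oner_neq0.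
pose q i := num i * \prod_(k | k != i) den k.
have q0 i : (q i == 0) = (c i == 0).
  rewrite mulf_eq0 num0; case: (c i == 0) => //=.
  by apply/negbTE/prodf_neq0 => k _.
have [m' cm' mmax] := @arg_maxnP _ i0 (fun i => c i != 0) (fun i : 'I_m.+1 => i : nat) ci0.
(* q i is the i-th coefficient multiplied by all the denominators. *)
exists m', (fun i => q (inord i)); split; first by rewrite inord_val q0.
have /filter_forall nd := fun i => near_FD (ev_near_neq0 (den0 i)).
apply: filterS2 nd h => z nd [dz sz]; split.
  by move=> i im; apply: dz; apply: leq_trans im _; rewrite -ltnS ltn_ord.
rewrite (big_ord_widen m.+1 (fun i => ev (q (inord i)) z * derive1n i F z)) //.
rewrite -[RHS](mulr0 (\prod_k ev (den k) z)) -[in RHS]sz mulr_sumr big_mkcond /=.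
apply: eq_bigr => i _; rewrite inord_val; case: ifP => [_|/negbT].
  rewrite /q evM ev_prod [in RHS](bigD1 i) //= /ratfun_eval -/(num i) -/(den i).
  rewrite -/(ev (num i) z) -/(ev (den i) z); set P := \prod_(k | _) _.
  by field; exact: nd.
rewrite -leqNgt => mi; have ci : c i = 0.
  by apply/eqP/negPn/negP => /mmax h'; move: mi; rewrite ltnNge; apply/negP/negPn.
have n0 : num i = 0 by apply/eqP; rewrite num0 ci.
by rewrite /ratfun_eval -/(num i) n0 rmorph0 horner0 mul0r mul0r mulr0.
Qed.

End Dom.
End ODE.

(** * From G-functions to holonomic functions *)

Section Closure.
Variables (R : realType) (K : fieldType) (phi : {rmorphism K -> R[i]}).
Local Notation C := (R[i]^o).
Variable D : set C.
Hypotheses (oD : open D) (D0 : forall z, D z -> z != 0).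
Local Notation FD := (within D (nbhs (0 : C))).

(** The companion system: its unknowns are the derivatives of order below m. *)
Lemma ode_diffmod (F : C -> C) (m : nat) (p : nat -> {poly K}) : p m != 0 ->
  (\forall z \near FD, (forall i, (i < m)%N -> derivable (derive1n i F) z 1) /\
    \sum_(i < m.+1) ev phi (p i) z * derive1n i F z = 0) ->
  diffmod phi D F.
Proof.
move=> pm0 h.
exists 'I_m, (fun i : 'I_m => derive1n i F), (p m),
  (fun i k : 'I_m => if (i.+1 == m)%N then - p k else (k == i.+1 :> nat)%:R * p m),
  (fun i : 'I_m => (i == 0 :> nat)%:R); split=> //.
apply: filterS2 h (near_FD D0 (ev_near_neq0 phi pm0)) => z [dz sz] pz; split.
  move=> i; split; first by apply: dz.
  have [im|im] := eqVneq i.+1 m.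
    move: sz; rewrite big_ord_recr /= => /eqP; rewrite addrC addr_eq0 => /eqP sz.
    rewrite -[derive1 _ z]/(derive1n i.+1 F z) im sz.
    by rewrite -sumrN; apply: eq_bigr => k _; rewrite evN mulNr.
  rewrite -[derive1 _ z]/(derive1n i.+1 F z).
  have im' : (i.+1 < m)%N by rewrite ltn_neqAle im ltn_ord.
  rewrite (bigD1 (Ordinal im')) //= eqxx mul1r big1 ?addr0 // => k.
  by rewrite -val_eqE /= => /negPf ->; rewrite mul0r ev0 mul0r.
(* In order 0 the equation forces F = 0, which the empty family represents. *)
case: m p pm0 dz sz pz => [|m] p pm0 dz sz pz.
  rewrite big_ord0; move: sz; rewrite big_ord1 => /eqP.
  by rewrite mulf_eq0 (negPf pz) => /eqP.
by rewrite big_ord_recl /= ev1 mul1r big1 ?addr0 // => k _; rewrite ev0 mul0r.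
Qed.

Lemma diffmodZ (c : K) F : diffmod phi D F -> diffmod phi D (fun z => phi c * F z).
Proof.
move=> [I [Y [e [U [v [e0 sys]]]]]]; exists I, Y, e, U, (fun a => c%:P * v a).
split=> //; apply: filterS sys => z [s ->]; split=> //.
by rewrite mulr_sumr; apply: eq_bigr => a _; rewrite evM evC mulrA.
Qed.

Lemma diffmod_mul_exponential (E : C -> C) (c : K) F :
  (\forall z \near FD, is_derive z (1 : C) E (phi c / z * E z)) ->
  diffmod phi D F -> diffmod phi D (fun z => E z * F z).
Proof.
move=> hE [I [Y [e [U [v [e0 sys]]]]]].
exists I, (fun a z => E z * Y a z), ('X * e),
  (fun a b => 'X * U a b + (a == b)%:R * (c%:P * e)), v.
split; first by rewrite mulf_neq0 ?polyX_eq0.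
have nz : \forall z \near FD, z != 0.
  by apply: (near_FD D0); apply: (@filterE _ (nbhs (0 : C))).
apply: filterS3 hE sys nz => z Ez [s ->] z0; split; last first.
  by rewrite mulr_sumr; apply: eq_bigr => a _; ring.
move=> a; have [da sa] := s a; have dM := cderM Ez (derivable_cder da).
split; first exact: cder_derivable dM.
rewrite (cder_val dM) evM evX.
under eq_bigr => b _ do rewrite evD !evM evX mulrDl.
rewrite big_split /=.
have -> : \sum_b ev phi (a == b)%:R z * (ev phi c%:P z * ev phi e z) * (E z * Y b z)
    = phi c * ev phi e z * (E z * Y a z).
  rewrite (bigD1 a) //= eqxx ev1 evC mul1r big1 ?addr0 // => b /negPf.
  by rewrite eq_sym => ->; rewrite ev0 !mul0r.
have -> : \sum_b z * ev phi (U a b) z * (E z * Y b z) = z * E z * (ev phi e z * derive1 (Y a) z).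
  by rewrite sa mulr_sumr; apply: eq_bigr => b _; ring.
by move: (derive1 _ _) (Y a z) (E z) (ev phi e z) => a1 a2 a3 a4; field.
Qed.

(** The products L Y are adjoined to the family Y, since
    (L Y)' = L Y' + Y / z. *)
Lemma diffmod_mul_log (L : C -> C) F :
  (\forall z \near FD, is_derive z (1 : C) L z^-1) ->
  diffmod phi D F -> diffmod phi D (fun z => L z * F z).
Proof.
move=> hL [I [Y [e [U [v [e0 sys]]]]]].
exists (I + I)%type, (fun a z => match a with inl a => Y a z | inr a => L z * Y a z end),
  ('X * e),
  (fun a b => match a, b with inl a, inl b => 'X * U a b | inr a, inr b => 'X * U a b
    | inr a, inl b => (a == b)%:R * e | _, _ => 0 end),
  (fun a => match a with inl a => 0 | inr a => v a end).
split; first by rewrite mulf_neq0 ?polyX_eq0.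
have nz : \forall z \near FD, z != 0.
  by apply: (near_FD D0); apply: (@filterE _ (nbhs (0 : C))).
apply: filterS3 hL sys nz => z Lz [s ->] z0; split; last first.
  rewrite big_sumType /= [X in _ = X + _]big1 ?add0r; last by move=> a _; rewrite ev0 mul0r.
  by rewrite mulr_sumr; apply: eq_bigr => a _; ring.
case=> a; have [da sa] := s a; rewrite big_sumType /=.
  split=> //; rewrite [X in _ + X]big1 ?addr0; last by move=> b _; rewrite ev0 mul0r.
  rewrite evM evX -mulrA -[X in z * X]/(ev phi e z * derive1 (Y a) z) sa mulr_sumr.
  by apply: eq_bigr => b _; rewrite evM evX; ring.
have dM := cderM Lz (derivable_cder da).
split; first exact: cder_derivable dM.
rewrite (cder_val dM) evM evX (bigD1 a) //= eqxx mul1r.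
rewrite [X in (_ + X) + _]big1 ?addr0; last first.
  by move=> b /negPf; rewrite eq_sym => ->; rewrite mul0r ev0 mul0r.
have -> : \sum_b ev phi ('X * U a b) z * (L z * Y b z) = z * L z * (ev phi e z * derive1 (Y a) z).
  by rewrite sa mulr_sumr; apply: eq_bigr => b _; rewrite evM evX; ring.
by move: (derive1 _ _) (Y a z) (L z) (ev phi e z) => a1 a2 a3 a4; field.
Qed.

End Closure.

Section Backward.
Variables (R : realType) (iota : {rmorphism algC -> R[i]}).
Local Notation C := (R[i]^o).

Lemma ev_map (K : fieldType) (phi : {rmorphism K -> R[i]}) (p : {poly K}) (z : C) :
  ev idfun (map_poly phi p) z = ev phi p z.
Proof. by rewrite /ev map_poly_id. Qed.

Lemma diffmod_map (K : fieldType) (phi : {rmorphism K -> R[i]}) (D : set C) F :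
  diffmod phi D F -> diffmod idfun D F.
Proof.
move=> [I [Y [e [U [v [e0 sys]]]]]].
exists I, Y, (map_poly phi e), (fun a b => map_poly phi (U a b)), (fun a => map_poly phi (v a)).
split; first by rewrite map_poly_eq0.
apply: filterS sys => z [s ->]; split.
  move=> a; have [da sa] := s a; split=> //; rewrite ev_map sa.
  by apply: eq_bigr => b _; rewrite ev_map.
by apply: eq_bigr => b _; rewrite ev_map.
Qed.

Lemma punctured_open : open [set z : C | z <> 0].
Proof.
rewrite openE => z /eqP z0; apply/nbhsCP; exists (Normc.normc z); first by rewrite normc_gt0.
by move=> y h yE; move: h; rewrite yE sub0r normcN ltxx.
Qed.

Variables (u : C) (L : C -> C).
Hypotheses (u0 : u != 0) (hL : log_determination u L).
Local Notation FD := (within (slit_plane u) (nbhs (0 : C))).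

Lemma near_slit : \forall z \near FD, slit_plane u z.
Proof. exact: withinT. Qed.

Lemma near_log : \forall z \near FD, is_derive z (1 : C) L z^-1.
Proof. by apply: filterS near_slit => z; exact: cder_log. Qed.

Lemma cder_power (c : R[i]) (z : C) : slit_plane u z ->
  is_derive z (1 : C) (fun y => cexp (c * L y : C)) (c / z * cexp (c * L z : C)).
Proof.
move=> zu; have h := cderM (cder_cst c z) (cder_log u0 hL zu).
have := @cder_comp R (@cexp R) (fun y => c * L y) z _ _ (cder_cexp (c * L z : C)) h.
by rewrite mul0r add0r mulrC.
Qed.

Lemma Gfunction_diffmod (f : nat -> algC) : Gfunction iota f ->
  diffmod idfun (slit_plane u) (psum iota f).
Proof.
have S0 : forall z : C, [set z | z <> 0] z -> z != 0 by move=> z /eqP.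
case=> _ /(ode_poly S0)[m [p [pm0 h]]].
apply: (@diffmod_map _ iota).
apply: (ode_diffmod (@slit_neq0 _ u) pm0).
apply: (near_FD (@slit_neq0 _ u)).
by apply: (@filterS _ (nbhs (0 : C)) _ _ _ _ h) => z hz /eqP; exact: hz.
Qed.

Lemma Gterm_diffmod (lam c : R[i]) (j : nat) (f : nat -> algC) : Gfunction iota f ->
  diffmod idfun (slit_plane u)
    (fun z => lam * cexp (c * L z : C) * L z ^+ j * psum iota f z).
Proof.
move=> Gf; have S0 := @slit_neq0 _ u.
have h1 : diffmod idfun (slit_plane u) (fun z => L z ^+ j * psum iota f z).
  elim: j => [|j IH].
    by under eq_fun do rewrite expr0 mul1r; exact: Gfunction_diffmod.
  under eq_fun do rewrite exprS -mulrA.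
  exact: (diffmod_mul_log S0 near_log IH).
under eq_fun do rewrite -2!mulrA; apply: (@diffmodZ _ _ idfun).
apply: (@diffmod_mul_exponential _ _ idfun _ S0 (fun z => cexp (c * L z : C)) c) h1.
by apply: filterS near_slit => z zu; exact: cder_power.
Qed.

Lemma nilsson_Gfunction_holonomic F : nilsson_form iota (Gfunction iota) u L F ->
  NGA0 iota u L F /\ holonomic (slit_plane u) F.
Proof.
move=> [S [lam [f [hf hF]]]]; split.
  by exists S, lam, f; split=> // al j k /hf[].
apply: (diffmod_ode (slit_open u0) (@slit_neq0 _ u)).
apply: (diffmod_near (F := fun z => \sum_(s <- S)
   let: (alpha, j, k) := s in
        lam alpha j k * cexp (ratr alpha * L z) * L z ^+ j
          * psum iota (f alpha j k) z)).
  by apply: filterS hF => z ->.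
rewrite (_ : (fun z => _) = fun z => \sum_(s <- S) if s \in S then
    let: (alpha, j, k) := s in
        lam alpha j k * cexp (ratr alpha * L z) * L z ^+ j
          * psum iota (f alpha j k) z else 0); last first.
  by apply/funext => z; apply: eq_big_seq => s ->.
apply: diffmod_sum => -[[al j] k]; have [/hf Gf|_] := boolP (_ \in S); last exact: diffmod0.
exact: Gterm_diffmod.
Qed.

End Backward.

(** * Polynomials and the Euler operator acting on coefficients *)

Section Conv.
Variable K : comNzRingType.
(** The action of K[z] on power series. *)
Definition polyact (p : {poly K}) (a : nat -> K) (n : nat) : K :=
  \sum_(i < n.+1) p`_i * a (n - i)%N.

Lemma polyact0 a : polyact 0 a = fun=> 0.
Proof. by apply/funext => n; rewrite /polyact big1 // => i _; rewrite coef0 mul0r. Qed.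

Lemma polyact_MXaddC p c a : polyact (p * 'X + c%:P) a = fun n => seq_shift (polyact p a) n + c * a n.
Proof.
apply/funext => n; rewrite /polyact big_ord_recl subn0 coefD coefMX coefC eqxx add0r addrC.
congr (_ + _); case: n => [|n]; first by rewrite big_ord0.
by apply: eq_bigr => i _; rewrite coefD coefMX coefC /= addr0.
Qed.

End Conv.

Section PactSum.
Variables (R : realType).
Local Notation C := (R[i]^o).

Lemma geom_bounded_polyact (p : {poly R[i]}) (a : nat -> C) : geom_bounded a -> geom_bounded (polyact p a : nat -> C).
Proof.
move=> ca; elim/poly_ind: p => [|p c IH]; first by rewrite polyact0; exact: geom_bounded0.
by rewrite polyact_MXaddC; apply: geom_boundedD; [exact: geom_bounded_shift | exact: geom_boundedZ].
Qed.

Lemma cpsum_polyact (p : {poly R[i]}) (a : nat -> C) : geom_bounded a ->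
  \forall z \near (0 : C), cpsum (polyact p a : nat -> C) z = p.[z] * cpsum a z.
Proof.
move=> ca; elim/poly_ind: p => [|p c IH].
  by apply: (@filterE _ (nbhs (0 : C))) => z; rewrite polyact0 cpsum0 horner0 mul0r.
have cp := geom_bounded_polyact p ca.
apply: filterS2 (filterI IH (cpsum_shift cp)) (filterI (cpsumD (geom_bounded_shift cp) (geom_boundedZ c ca)) (cpsumZ c ca)).
by move=> z [h1 h2] [h3 h4]; rewrite polyact_MXaddC h3 h4 h2 h1 hornerMXaddC mulrDl mulrA [z * _]mulrC.
Qed.

Lemma map_polyact (K : fieldType) (iota : {rmorphism K -> R[i]}) (p : {poly K}) (a : nat -> K) :
  (fun n => iota (polyact p a n) : C) = polyact (map_poly iota p) (fun n => iota (a n)).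
Proof.
apply/funext => n; rewrite /polyact rmorph_sum; apply: eq_bigr => i _.
by rewrite rmorphM coef_map.
Qed.

(** The k-th iterate of theta = z d/dz on power series. *)
Definition euler_iter (K : nzRingType) (k : nat) (a : nat -> K) : nat -> K := fun n => n%:R ^+ k * a n.

Lemma geom_bounded_euler_iter k (a : nat -> C) : geom_bounded a -> geom_bounded (euler_iter k a : nat -> C).
Proof.
move=> ca; elim: k => [|k IH]; first by rewrite /euler_iter; under eq_fun do rewrite expr0 mul1r.
have := geom_bounded_natM 0 IH; rewrite /euler_iter.
by under eq_fun do rewrite addr0 mulrA -exprS.
Qed.

Variable iota : {rmorphism algC -> R[i]}.

Lemma psum_euler_iter k (a : nat -> algC) :
  psum iota (euler_iter k a) = cpsum (euler_iter k (fun n => iota (a n) : C)).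
Proof.
rewrite psumE; congr cpsum; apply/funext => n.
by rewrite /euler_iter rmorphM rmorphXn rmorph_nat.
Qed.

(** The series theta^k h_s with k < m form a differential system: theta sends
    each of them to the next one, and the hypothesis closes the system at k = m. *)
Lemma theta_system (S : finType) (h : S -> nat -> algC) (m : nat) (d : {poly algC})
    (V : S -> 'I_m -> S -> {poly algC}) :
  d != 0 -> (forall s, geom_bounded (fun n => iota (h s n) : C)) ->
  (forall s, \forall z \near (0 : C), ev iota d z * psum iota (euler_iter m (h s)) z =
     \sum_(k < m) \sum_s' ev iota (V s k s') z * psum iota (euler_iter k (h s')) z) ->
  forall s, diffmod iota [set z : C | z <> 0] (psum iota (h s)).
Proof.
move=> d0 ch /filter_forall hsys s0.
have S0 : forall z : C, [set z | z <> 0] z -> z != 0 by move=> z /eqP.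
exists ('I_m * S)%type, (fun a : 'I_m * S => psum iota (euler_iter a.1 (h a.2))), ('X * d),
 (fun a b : 'I_m * S => if (a.1.+1 == m)%N then V a.2 b.1 b.2
    else ((b.1 == a.1.+1 :> nat) && (b.2 == a.2))%:R * d),
 (fun a : 'I_m * S => ((a.1 == 0 :> nat) && (a.2 == s0))%:R).
split; first by rewrite mulf_neq0 ?polyX_eq0.
have thi0 a : euler_iter 0 a = a :> (nat -> algC).
  by apply/funext => n; rewrite /euler_iter expr0 mul1r.
have nz : \forall z \near within [set z : C | z <> 0] (nbhs (0 : C)), z != 0.
  by apply: (near_FD S0); apply: (@filterE _ (nbhs (0 : C))).
have /filter_forall hder : forall a : 'I_m * S, \forall z \near (0 : C), z != 0 ->
    is_derive (z : C) (1 : C) (psum iota (euler_iter a.1 (h a.2)))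
     (psum iota (euler_iter a.1.+1 (h a.2)) z / z).
  move=> a; rewrite !psum_euler_iter; have := cder_cpsum (geom_bounded_euler_iter a.1 (ch a.2)).
  apply: filterS => z hz z0; have := hz z0.
  by rewrite (_ : (fun n => n%:R * _) = euler_iter a.1.+1 (fun n => iota (h a.2 n) : C)) //;
    apply/funext => n; rewrite /euler_iter mulrA -exprS.
have nd := near_FD S0 (ev_near_neq0 iota d0).
have hd := @near_FD0 _ [set z : C | z <> 0] _ hder.
have hs := @near_FD0 _ [set z : C | z <> 0] _ hsys.
apply: filterS3 (filterI nd nz) hd hs.
move=> z [dz z0] {}hder {}hsys; split.
  move=> a; have ha := hder a z0; split; first exact: cder_derivable ha.
  rewrite (cder_val ha) evM evX.
  have -> : z * ev iota d z * (psum iota (euler_iter a.1.+1 (h a.2)) z / z) =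
      ev iota d z * psum iota (euler_iter a.1.+1 (h a.2)) z.
    by move: (psum _ _ _) (ev _ _ _) => x y; field.
  case: eqP => [am|/eqP am]; first by rewrite am hsys pair_bigA.
  have am' : (a.1.+1 < m)%N by rewrite ltn_neqAle am ltn_ord.
  rewrite (bigD1 (Ordinal am', a.2)) //= !eqxx mul1r big1 ?addr0 // => -[b1 b2] /=.
  rewrite xpair_eqE -val_eqE /= => /negPf ->.
  by rewrite mul0r ev0 mul0r.
(* For m = 0 the hypothesis says d h_s = 0, and the system is empty. *)
case: m d0 V hsys {hder nd} => [|m] d0' V' hsys.
  rewrite big1 => [|[[]]] //; have := hsys s0; rewrite big_ord0 thi0 => /eqP.
  by rewrite mulf_eq0 (negPf dz) => /eqP.
rewrite (bigD1 (ord0, s0)) //= !eqxx ev1 mul1r thi0 big1 ?addr0 // => -[b1 b2] /=.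
rewrite xpair_eqE -val_eqE /= => /negPf ->.
by rewrite ev0 mul0r.
Qed.

End PactSum.

(** * Euler derivatives of Nilsson series *)

Section Phi.
Variable R : realType.
Local Notation C := (R[i]^o).
Variables (u : C) (L : C -> C).
Hypotheses (u0 : u != 0) (hL : log_determination u L).
Local Notation FD := (within (slit_plane u) (nbhs (0 : C))).
Variables (N J : nat) (beta : 'I_N -> C).

Definition nilsson_coefs := 'I_N -> nat -> nat -> C.
Definition admissible (G : nilsson_coefs) : Prop :=
  (forall q j, geom_bounded (G q j)) /\ (forall q j, (J <= j)%N -> forall n, G q j n = 0).

Definition Phi (G : nilsson_coefs) (z : C) : C :=
  \sum_(q < N) \sum_(j < J) cexp (beta q * L z : C) * L z ^+ j * cpsum (G q j) z.

(** The operator theta - c on the coefficients of a Nilsson series: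
    theta z^(beta + n) (log z)^j is (beta + n) z^(beta + n) (log z)^j plus
    j z^(beta + n) (log z)^(j-1), so the coefficient at j receives the one at j + 1. *)
Definition twisted_euler (c : C) (G : nilsson_coefs) : nilsson_coefs := fun q j n =>
  (n%:R + (beta q - c)) * G q j n + j.+1%:R * G q j.+1 n.

(** The operator z^i (d/dz)^i, which is the falling factorial
    theta (theta - 1) ... (theta - i + 1). *)
Fixpoint falling_euler (i : nat) (G : nilsson_coefs) : nilsson_coefs :=
  if i is k.+1 then twisted_euler k%:R (falling_euler k G) else G.

Lemma admissible_twisted_euler c G : admissible G -> admissible (twisted_euler c G).
Proof.
move=> [cG zG]; split=> [q j|q j hj n].
  by apply: geom_boundedD; [exact: geom_bounded_natM | exact: geom_boundedZ].
by rewrite /twisted_euler !zG ?(leqW hj) // !mulr0 addr0.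
Qed.

Lemma admissible_falling_euler i G : admissible G -> admissible (falling_euler i G).
Proof. by move=> aG; elim: i => [//|i IH]; exact: admissible_twisted_euler. Qed.

Lemma sum_shift (x : C) (g : nat -> C) : g J = 0 ->
  \sum_(j < J) (j%:R * x ^+ j.-1) * g j = \sum_(j < J) x ^+ j * (j.+1%:R * g j.+1).
Proof.
case: J => [|k] gk; first by rewrite !big_ord0.
rewrite big_ord_recl big_ord_recr /= !mul0r add0r gk !mulr0 addr0.
by apply: eq_bigr => j _; rewrite /bump /= add1n; ring.
Qed.

Lemma cder_logX (z : C) j : slit_plane u z ->
  is_derive z (1 : C) (fun y => L y ^+ j) (j%:R * L z ^+ j.-1 / z).
Proof.
move=> zu; elim: j => [|j IH].
  by rewrite !mul0r; under eq_fun do rewrite expr0; exact: cder_cst.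
under eq_fun do rewrite exprS.
have := cderM (cder_log u0 hL zu) IH.
have z0 := slit_neq0 zu.
rewrite (_ : z^-1 * _ + _ = j.+1%:R * L z ^+ j.+1.-1 / z) //.
rewrite -natr1; move: (L z) (z^-1) => a b.
by case: j {IH} => [|j] /=; rewrite ?expr0 ?exprS; ring.
Qed.

Lemma cder_Phi c G : admissible G -> \forall z \near FD,
  is_derive z (1 : C) (Phi G) ((Phi (twisted_euler c G) z + c * Phi G z) / z).
Proof.
move=> [cG zG]; have S0 := @slit_neq0 _ u.
pose th q j : nat -> C := fun n => n%:R * G q j n.
have cth q j : geom_bounded (th q j).
  by have := geom_bounded_natM 0 (cG q j); under eq_fun do rewrite addr0.
have /filter_forall nd : forall q : 'I_N, \forall z \near FD, forall j : 'I_J,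
    is_derive z (1 : C) (cpsum (G q j)) (cpsum (th q j) z / z).
  by move=> q; apply: filter_forall => j; apply: (near_FD S0); exact: cder_cpsum.
have /filter_forall ns : forall q : 'I_N, \forall z \near FD, forall j : 'I_J,
    cpsum (twisted_euler c G q j) z = cpsum (th q j) z + (beta q - c) * cpsum (G q j) z
       + j.+1%:R * cpsum (G q j.+1) z.
  move=> q; apply: filter_forall => j; apply: near_FD0.
  have c1 := geom_boundedZ (beta q - c) (cG q j); have c2 := geom_boundedZ j.+1%:R (cG q j.+1).
  apply: filterS3 (cpsumD (geom_boundedD (cth q j) c1) c2) (filterI (cpsumD (cth q j) c1) (cpsumZ (beta q - c) (cG q j))) 
     (cpsumZ j.+1%:R (cG q j.+1)) => z h [h1 h2] h3.
  rewrite -h3 -h2 -h1 -h; congr (cpsum _ z); apply/funext => n.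
  by rewrite /twisted_euler /th mulrDl.
apply: filterS3 nd ns (near_slit u) => z {}nd {}ns zu; have z0 := S0 z zu.
pose D q (j : 'I_J) : C := beta q / z * cexp (beta q * L z : C) * L z ^+ j * cpsum (G q j) z
  + cexp (beta q * L z : C) * (j%:R * L z ^+ j.-1 / z) * cpsum (G q j) z
  + cexp (beta q * L z : C) * L z ^+ j * (cpsum (th q j) z / z).
have dPhi : is_derive z (1 : C) (Phi G) (\sum_(q < N) \sum_(j < J) D q j).
  apply: cder_sum => q; apply: cder_sum => j.
  have := cderM (cderM (cder_power u0 hL (beta q) zu) (cder_logX j zu)) (nd q j).
  by rewrite /D mulrDl.
rewrite (_ : _ / z = \sum_(q < N) \sum_(j < J) D q j) //.
rewrite /Phi mulr_sumr -big_split mulr_suml; apply: eq_bigr => q _ /=.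
have gJ : cpsum (G q J) z = 0.
  by rewrite (_ : G q J = fun=> 0) ?cpsum0 //; apply/funext => n; exact: zG.
have shift := @sum_shift (L z) (fun j => cpsum (G q j) z) gJ.
transitivity (cexp (beta q * L z : C) / z * \sum_(j < J) (L z ^+ j * (j.+1%:R * cpsum (G q j.+1) z))
  + \sum_(j < J) cexp (beta q * L z : C) / z * (L z ^+ j * (cpsum (th q j) z + beta q * cpsum (G q j) z))).
  rewrite !mulr_sumr -!big_split mulr_suml /=; apply: eq_bigr => j _; rewrite ns.
  move: (cpsum (th q j) z) (cpsum (G q j.+1) z) (cpsum (G q j) z) (cexp (beta q * L z : C)) => a b d e.
  by field.
rewrite -shift mulr_sumr -big_split; apply: eq_bigr => j _; rewrite /D /=.
move: (cpsum (th q j) z) (cpsum (G q j) z) (cexp (beta q * L z : C)) => a b d.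
by field.
Qed.

Lemma euler_derivatives F G i : admissible G -> (\forall z \near FD, F z = Phi G z) ->
  \forall z \near FD, z ^+ i * derive1n i F z = Phi (falling_euler i G) z.
Proof.
move=> aG FG; elim: i => [|i IH].
  by apply: filterS FG => z Fz; rewrite expr0 mul1r.
have aT := admissible_falling_euler i aG.
apply: filterS2 (near_open (slit_open u0) IH) (cder_Phi i%:R aT) => z [zu nz] dz.
have z0 := slit_neq0 zu; have hz := nbhs_singleton nz.
have nz0 : \forall y \near z, y != 0.
  by have := slit_open u0; rewrite openE => /(_ z zu); apply: filterS => y; exact: slit_neq0.
pose X := 'X^i : {poly R[i]}.
have XE y : X.[y] = y ^+ i by rewrite hornerXn.
have dX := cder_poly X z.
have X0 : X.[z] != 0 by rewrite XE expf_neq0.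
have nF : \forall y \near z, derive1n i F y =
    Phi (falling_euler i G) y * (X.[y])^-1.
  apply: filterS2 nz nz0 => y ry y0; rewrite -ry XE mulrC mulKf //.
  by rewrite expf_neq0.
have dF := derive1_near nF (cderM dz (cderV X0 dX)).
rewrite -[derive1n i.+1 F z]/(derive1 (derive1n i F) z) (cder_val dF).
have -> : Phi (falling_euler i.+1 G) z = Phi (twisted_euler i%:R (falling_euler i G)) z by [].
rewrite XE /X derivXn hornerMn hornerXn -(mulr_natr (z ^+ i.-1)).
move: (Phi (twisted_euler _ _) z) (Phi (falling_euler i G) z) => a b.
case: (i) => [|k] /=; first by rewrite expr1 !expr0; field.
rewrite !exprS; have zk : z ^+ k != 0 by rewrite expf_neq0.
move: (z ^+ k) zk => w w0; field.
by rewrite z0 w0.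
Qed.

End Phi.

(** * Descent of the equation to algebraic coefficients *)

Section Functional.
Variables (K F : fieldType) (iota : {rmorphism K -> F}) (phi : F -> K).
Hypothesis lin : scalar_functional iota phi.

Lemma functional0 : phi 0 = 0.
Proof. by have [_ sc] := lin; rewrite -(mul0r 0) -(rmorph0 iota) sc mul0r. Qed.

Lemma functional_sum I (r : seq I) (f : I -> F) :
  phi (\sum_(i <- r) f i) = \sum_(i <- r) phi (f i).
Proof.
have [ad _] := lin; elim: r => [|i r IH]; first by rewrite !big_nil functional0.
by rewrite !big_cons ad IH.
Qed.

(** Scalars of K pass through phi, so on series with coefficients in K
    it acts on the polynomial alone. *)
Lemma functional_polyact (p : {poly F}) (a : nat -> K) n :
  phi (polyact p (fun n => iota (a n)) n) = polyact (map_poly phi p) a n.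
Proof.
have [_ sc] := lin; rewrite /polyact functional_sum; apply: eq_bigr => i _.
by rewrite mulrC sc mulrC coef_map_id0 // functional0.
Qed.

Lemma functional_horner (p : {poly F}) (x : K) :
  (map_poly phi p).[x] = phi (p.[iota x]).
Proof.
have [_ sc] := lin; rewrite (horner_coef p) functional_sum /map_poly horner_poly.
by apply: eq_bigr => i _; rewrite -rmorphXn mulrC -sc mulrC.
Qed.

End Functional.

Lemma polyact_suml (K : comNzRingType) I (r : seq I) (p : I -> {poly K}) a n :
  polyact (\sum_(i <- r) p i) a n = \sum_(i <- r) polyact (p i) a n.
Proof.
rewrite /polyact exchange_big; apply: eq_bigr => k _.
by rewrite coef_sum mulr_suml.
Qed.

Lemma polyact_sumr (K : comNzRingType) I (r : seq I) (p : {poly K}) (a : I -> nat -> K) n :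
  polyact p (fun n => \sum_(i <- r) a i n) n = \sum_(i <- r) polyact p (a i) n.
Proof.
by rewrite /polyact exchange_big; apply: eq_bigr => k _; rewrite mulr_sumr.
Qed.

Lemma polyact_scale (K : comNzRingType) (c : K) (p : {poly K}) a n :
  polyact p (fun n => c * a n) n = polyact (c *: p) a n.
Proof. by rewrite /polyact; apply: eq_bigr => k _; rewrite coefZ mulrCA mulrA. Qed.

Section Relation.
Variable R : realType.
Local Notation C := (R[i]^o).
Variables (u : C) (L : C -> C).
Hypotheses (u0 : u != 0) (hL : log_determination u L).
Local Notation FD := (within (slit_plane u) (nbhs (0 : C))).
Variables (N J M : nat).
Let beta (q : 'I_N) : C := q%:R / N%:R - M%:R.

(** By [euler_derivatives], z^m times the equation is the Nilsson series whose
    coefficients are the sums in the conclusion.  Multiplying by z^M makes the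
    exponents q / N, and [nilsson_indep] applies. *)
Lemma ode_relation (F : C -> C) (G : nilsson_coefs R N) (m : nat) (p : nat -> {poly R[i]}) :
  admissible J G -> (\forall z \near FD, F z = Phi L J beta G z) ->
  (\forall z \near FD, \sum_(i < m.+1) (p i).[z] * derive1n i F z = 0) ->
  forall (q : 'I_N) (j : 'I_J) n,
    \sum_(i < m.+1) polyact (p i * 'X^(m - i)) (falling_euler beta i G q j) n = 0.
Proof.
move=> aG FG ode; have S0 := @slit_neq0 _ u; have [_ hE] := hL.
pose H (q : 'I_N) (j : nat) : nat -> C := fun n =>
  \sum_(i < m.+1) polyact (p i * 'X^(m - i)) (falling_euler beta i G q j) n.
have cT i q j : geom_bounded (falling_euler beta i G q j) by case: (admissible_falling_euler beta i aG).
have cH q j : geom_bounded (H q j) by apply: geom_bounded_sum => i; exact: geom_bounded_polyact.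
suff : forall (q : 'I_N) (j : 'I_J) n, H q j n = 0 by [].
apply: (@nilsson_indep _ u L N J (fun q j => H q j) u0 hL) => //.
have /filter_forall nH : forall q : 'I_N, \forall z \near FD, forall j : 'I_J,
    cpsum (H q j) z = \sum_(i < m.+1) (p i).[z] * z ^+ (m - i) * cpsum (falling_euler beta i G q j) z.
  move=> q; apply: filter_forall => j; apply: near_FD0.
  have /filter_forall h1 := fun i : 'I_m.+1 => cpsum_polyact (p i * 'X^(m - i)) (cT i q j).
  have h2 := cpsum_sum (index_enum 'I_m.+1) (fun i => geom_bounded_polyact (p i * 'X^(m - i)) (cT i q j)).
  apply: filterS2 h1 h2 => z h1 ->; apply: eq_bigr => i _.
  by rewrite h1 hornerM hornerXn.
have /filter_forall nD := fun i : 'I_m.+1 => euler_derivatives u0 hL i aG FG.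
apply: filterS3 (filterI nH nD) ode (near_slit u) => z [{}nH {}nD] hz zu.
have z0 := S0 z zu.
transitivity (z ^+ M * (z ^+ m * \sum_(i < m.+1) (p i).[z] * derive1n i F z)); last first.
  by rewrite hz !mulr0.
transitivity (z ^+ M * \sum_(i < m.+1) (p i).[z] * z ^+ (m - i) * Phi L J beta (falling_euler beta i G) z); last first.
  congr (_ * _); rewrite [RHS]mulr_sumr; apply: eq_bigr => i _; rewrite -nD.
  have -> : z ^+ m = z ^+ (m - i) * z ^+ i by rewrite -exprD subnK // -ltnS.
  by move: (derive1n i F z) => a; ring.
rewrite /Phi.
under [in RHS]eq_bigr => i _ do rewrite mulr_sumr.
rewrite [in RHS]exchange_big /= [RHS]mulr_sumr; apply: eq_bigr => q _.
under [in RHS]eq_bigr => i _ do rewrite mulr_sumr.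
rewrite [in RHS]exchange_big /= [RHS]mulr_sumr; apply: eq_bigr => j _.
rewrite nH !mulr_sumr; apply: eq_bigr => i _.
have -> : cexp (q%:R / N%:R * L z : C) = z ^+ M * cexp (beta q * L z : C).
  rewrite -{2}(hE z zu) -cexp_natM -cexpD; congr cexp; rewrite /beta; ring.
by move: (cexp _) (cpsum _ _) => a b; ring.
Qed.

End Relation.

Lemma poly_nat_nonroot (K : numDomainType) (q : {poly K}) : q != 0 ->
  exists n : nat, q.[n%:R] != 0.
Proof.
move=> q0; apply: contrapT => /forallNP hn.
pose rs : seq K := [seq n%:R | n <- iota 0 (size q)].
have : (size rs < size q)%N.
  apply: max_poly_roots => //.
    by apply/allP => x /mapP[n _ ->]; rewrite /root; have /negP := hn n; rewrite negbK.
  by rewrite map_inj_uniq ?iota_uniq // => x y /eqP; rewrite eqr_nat => /eqP.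
by rewrite size_map size_iota ltnn.
Qed.

Section Expand.
Variables (K F : fieldType) (iota : {rmorphism K -> F}) (b : K).

(** The operator z^i (d/dz)^i sends the coefficient series of index j' to
    that of index j through this polynomial in theta. *)
Fixpoint falling_symbol (i : nat) (j j' : nat) : {poly K} :=
  if i is k.+1 then ('X + (b - k%:R)%:P) * falling_symbol k j j' + j.+1%:R *: falling_symbol k j.+1 j'
  else (j == j')%:R.

(** Lowering the power of the logarithm uses up one theta, so the terms
    off the diagonal have order less than i. *)
Lemma falling_symbol_lead i j j' : (size (falling_symbol i j j' - (j == j')%:R *: 'X^i)%R <= i)%N.
Proof.
elim: i j => [|i IH] j.
  by rewrite /= expr0 scaler_nat subrr size_poly0.
pose s j := falling_symbol i j j' - (j == j')%:R *: 'X^i.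
have sE j1 : falling_symbol i j1 j' = s j1 + (j1 == j')%:R *: 'X^i by rewrite /s subrK.
have hs j1 : (size (s j1) <= i)%N by exact: IH.
have hX (c : K) : (size (c *: 'X^i : {poly K})%R <= i.+1)%N.
  by apply: leq_trans (size_scale_leq _ _) _; rewrite size_polyXn.
rewrite [falling_symbol _ _ _]/= !sE.
rewrite (_ : _ - _ = 'X * s j + ((b - i%:R) *: s j + (b - i%:R) *: ((j == j')%:R *: 'X^i)
   + j.+1%:R *: (s j.+1 + (j.+1 == j')%:R *: 'X^i))); last first.
  rewrite -!mul_polyC exprS; move: (s j) (s j.+1) ('X^i) => a c d.
  by rewrite polyCB; ring.
have hsX j1 : (size (s j1) <= i.+1)%N by apply: leq_trans (hs _) _.
apply: leq_trans (size_polyD _ _) _; rewrite geq_max; apply/andP; split.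
  have [->|s0] := eqVneq (s j) 0; first by rewrite mulr0 size_poly0.
  by rewrite mulrC size_mulX // ltnS.
apply: leq_trans (size_polyD _ _) _; rewrite geq_max; apply/andP; split.
  apply: leq_trans (size_polyD _ _) _; rewrite geq_max; apply/andP; split.
    by apply: leq_trans (size_scale_leq _ _) _.
  by apply: leq_trans (size_scale_leq _ _) _.
apply: leq_trans (size_scale_leq _ _) _.
by apply: leq_trans (size_polyD _ _) _; rewrite geq_max hsX hX.
Qed.

Lemma falling_symbol_coef i j j' k : (i <= k)%N -> (falling_symbol i j j')`_k = ((j == j') && (i == k))%:R.
Proof.
move=> ik; rewrite -[falling_symbol i j j'](subrK ((j == j')%:R *: 'X^i)) coefD.
rewrite nth_default ?add0r; last exact: leq_trans (falling_symbol_lead i j j') ik.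
by rewrite coefZ coefXn [k == i]eq_sym -natrM mulnb.
Qed.

Lemma falling_symbol_size i j j' : (size (falling_symbol i j j') <= i.+1)%N.
Proof.
apply/leq_sizeP => k ik; rewrite falling_symbol_coef; last exact: ltnW.
by rewrite (ltn_eqF ik) andbF.
Qed.

End Expand.

Section Descent.
Variables (R : realType) (iota : {rmorphism algC -> R[i]}).
Local Notation C := (R[i]^o).
Variables (u : C) (L : C -> C).
Hypotheses (u0 : u != 0) (hL : log_determination u L).
Local Notation FD := (within (slit_plane u) (nbhs (0 : C))).
Variables (N J M r : nat) (mu : 'I_r -> R[i]).
Hypothesis imu : indep iota mu.
Variable h : 'I_N -> nat -> 'I_r -> nat -> algC.
Hypothesis ch : forall q j l, geom_bounded (fun n => iota (h q j l n) : C).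
Hypothesis h0 : forall q j l n, (J <= j)%N -> h q j l n = 0.
Let b (q : 'I_N) : algC := q%:R / N%:R - M%:R.
Let beta (q : 'I_N) : C := q%:R / N%:R - M%:R.
Let G : nilsson_coefs R N := fun q j n => \sum_l mu l * iota (h q j l n).

Lemma iota_exponent q : iota (b q) = beta q.
Proof. by rewrite rmorphB fmorph_div !rmorph_nat. Qed.

Lemma G_admissible : admissible J G.
Proof.
split=> [q j|q j hj n]; first by apply: geom_bounded_sum => l; exact: geom_boundedZ.
by rewrite /G big1 // => l _; rewrite h0 // rmorph0 mulr0.
Qed.

Lemma falling_euler_expand i q j n : falling_euler beta i G q j n =
  \sum_(j' < J) \sum_l mu l * iota ((falling_symbol (b q) i j j').[n%:R] * h q j' l n).
Proof.
elim: i j => [|i IH] j.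
  rewrite /=; have [jJ|Jj] := ltnP j J; last first.
    rewrite /G [LHS]big1 => [|l _]; last by rewrite h0 // rmorph0 mulr0.
    rewrite big1 // => j' _; rewrite big1 // => l _.
    by rewrite gtn_eqF ?horner0 ?mul0r ?rmorph0 ?mulr0 //; exact: leq_trans (ltn_ord j') Jj.
  rewrite (bigD1 (Ordinal jJ)) //= [X in _ = _ + X]big1 ?addr0 => [|j'].
    by apply: eq_bigr => l _; rewrite eqxx hornerC mul1r.
  rewrite -val_eqE eq_sym /= => /negPf ne; rewrite big1 // => l _.
  by rewrite ne horner0 mul0r rmorph0 mulr0.
rewrite /= /twisted_euler !IH !mulr_sumr -big_split; apply: eq_bigr => j' _ /=.
rewrite !mulr_sumr -big_split; apply: eq_bigr => l _ /=.
have -> : n%:R + (beta q - i%:R) = iota (n%:R + (b q - i%:R)).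
  by rewrite rmorphD (rmorphB iota (b q)) iota_exponent !rmorph_nat.
rewrite hornerD hornerZ hornerM hornerD hornerX hornerC -(rmorph_nat iota j.+1).
rewrite !rmorphM [X in _ = _ * (X * _)]rmorphD !rmorphM.
by ring.
Qed.

Variables (m : nat) (p : nat -> {poly R[i]}).
Hypothesis pm0 : p m != 0.
Local Notation X := ('I_m.+1 * ('I_J * 'I_r))%type.

Lemma falling_euler_iter i q j n : (i <= m)%N -> falling_euler beta i G q j n =
  \sum_(x : X) iota (falling_symbol (b q) i j x.2.1)`_x.1 * mu x.2.2 * iota (euler_iter x.1 (h q x.2.1 x.2.2) n).
Proof.
move=> im; rewrite falling_euler_expand.
rewrite -(pair_bigA _ (fun (k : 'I_m.+1) (y : 'I_J * 'I_r) =>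
  iota (falling_symbol (b q) i j y.1)`_k * mu y.2 * iota (euler_iter k (h q y.1 y.2) n))) exchange_big /=.
rewrite -(pair_bigA _ (fun (j' : 'I_J) (l : 'I_r) => \sum_(k < m.+1)
  iota (falling_symbol (b q) i j j')`_k * mu l * iota (euler_iter k (h q j' l) n))) /=.
apply: eq_bigr => j' _; apply: eq_bigr => l _.
rewrite (horner_coef_wide _ (leq_trans (falling_symbol_size _ _ _ _) (im : i.+1 <= m.+1)%N)).
rewrite mulr_suml rmorph_sum mulr_sumr; apply: eq_bigr => k _.
by rewrite /euler_iter !rmorphM !rmorphXn; ring.
Qed.

(** For x = (k, (j', l)), the coefficient of theta^k h_(q,j',l) in the relation
    of index (q, j). *)
Definition relcoef (q : 'I_N) (j : 'I_J) (x : X) : {poly R[i]} :=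
  \sum_(i < m.+1) (iota (falling_symbol (b q) i j x.2.1)`_x.1 * mu x.2.2) *: (p i * 'X^(m - i)).

(** In order m only the series of index j itself occurs, with coefficient
    mu_l p_m; the independence of the mu_l acts on these terms. *)
Lemma relcoef_top q j j' l : relcoef q j (ord_max, (j', l)) = ((j == j')%:R * mu l) *: p m.
Proof.
rewrite /relcoef big_ord_recr /= big1 ?add0r => [|i _].
  by rewrite falling_symbol_coef // eqxx andbT val_eqE rmorph_nat subnn expr0 mulr1.
rewrite falling_symbol_coef ?(ltnW (ltn_ord i)) // (ltn_eqF (ltn_ord i)) andbF.
by rewrite rmorph0 mul0r scale0r.
Qed.

Variable F : C -> C.
Hypothesis FG : \forall z \near FD, F z = Phi L J beta G z.
Hypothesis ode : \forall z \near FD, \sum_(i < m.+1) (p i).[z] * derive1n i F z = 0.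

Lemma scalar_relation q j n :
  \sum_(x : X) polyact (relcoef q j x) (fun n => iota (euler_iter x.1 (h q x.2.1 x.2.2) n)) n = 0.
Proof.
have := ode_relation u0 hL G_admissible FG ode q j n => rel; rewrite -[RHS]rel.
rewrite /relcoef; under eq_bigr => x _ do rewrite polyact_suml.
rewrite exchange_big; apply: eq_bigr => i _ /=.
under eq_bigr => x _ do rewrite -polyact_scale.
rewrite -polyact_sumr; congr (polyact _ _ n); apply/funext => k.
by rewrite falling_euler_iter // -ltnS.
Qed.

(** The functional turns a relation with complex coefficients between
    series with algebraic coefficients into one with algebraic coefficients. *)
Lemma functional_relation (phi : R[i] -> algC) q j : scalar_functional iota phi ->
  \forall z \near (0 : C),
  \sum_(x : X) ev iota (map_poly phi (relcoef q j x)) z * psum iota (euler_iter x.1 (h q x.2.1 x.2.2)) z = 0.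
Proof.
move=> lin; pose a (x : X) := euler_iter x.1 (h q x.2.1 x.2.2).
have rel n : \sum_(x : X) polyact (map_poly phi (relcoef q j x)) (a x) n = 0.
  rewrite -[RHS](functional0 lin) -[in RHS](scalar_relation q j n) (functional_sum lin).
  by apply: eq_bigr => x _; rewrite (functional_polyact lin).
have ca x : geom_bounded (fun n => iota (a x n) : C).
  have := geom_bounded_euler_iter x.1 (ch q x.2.1 x.2.2); congr geom_bounded; apply/funext => n.
  by rewrite /a /euler_iter rmorphM rmorphXn rmorph_nat.
have cs x := geom_bounded_polyact (map_poly iota (map_poly phi (relcoef q j x))) (ca x).
have /filter_forall h1 := fun x : X => cpsum_polyact (map_poly iota (map_poly phi (relcoef q j x))) (ca x).
apply: filterS2 h1 (cpsum_sum (index_enum X) cs) => z h1 h2.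
transitivity (cpsum (fun=> 0 : C) z); last exact: cpsum0.
transitivity (\sum_(x : X) cpsum (polyact (map_poly iota (map_poly phi (relcoef q j x))) (fun n => iota (a x n)) : nat -> C) z).
  by apply: eq_bigr => x _; rewrite h1 psumE.
rewrite -h2; congr (cpsum _ z); apply/funext => n.
rewrite -[RHS](rmorph0 iota) -[in RHS](rel n) rmorph_sum; apply: eq_bigr => x _.
by rewrite -map_polyact.
Qed.

(** Let a = p_m(n0) be nonzero and let the functionals phi_t be dual to the
    family a mu_l.  The relations obtained through them have the matrix
    Q t l = phi_t (mu_l p_m) in top order.  Its value at n0 is the identity, so det Q is
    nonzero, and multiplication by the adjugate of Q expresses det Q theta^m h_(q,j,l)
    through the theta^k h_(q,j',l') with k < m. *)
Theorem descent_diffmod (q : 'I_N) (j : 'I_J) (l : 'I_r) :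
  diffmod iota [set z : C | z <> 0] (psum iota (h q j l)).
Proof.
have [n0 a0] := poly_nat_nonroot pm0; set a := (p m).[_] in a0.
have amu : indep iota (fun l => a * mu l).
  move=> c hc; apply: imu; apply: (mulfI a0); rewrite mulr0 -[RHS]hc mulr_sumr.
  by apply: eq_bigr => l' _; rewrite mulrCA.
have /choice[phi hphi] : forall t : 'I_r, exists phi : R[i] -> algC,
    scalar_functional iota phi /\ forall s, phi (a * mu s) = (s == t)%:R.
  by move=> t; have [phi h1 h2] := dual_functional t amu; exists phi.
pose Q : 'M[{poly algC}]_r := \matrix_(t, l) map_poly (phi t) (mu l *: p m).
have detQ : \det Q != 0.
  have : (\det Q).[n0%:R] = 1.
    rewrite -[LHS]/(horner_eval n0%:R (\det Q)) -det_map_mx -[RHS](det1 _ r).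
    congr (\det _); apply/matrixP => t s; rewrite [RHS]mxE mxE [Q t s]mxE /horner_eval.
    have [lin dual] := hphi t.
    rewrite -[LHS]/((map_poly (phi t) (mu s *: p m)).[n0%:R]).
    by rewrite (functional_horner lin) hornerZ rmorph_nat mulrC dual eq_sym.
  by apply: contra_eq_neq => ->; rewrite horner0 eq_sym oner_eq0.
pose S := ('I_N * ('I_J * 'I_r))%type.
pose hS (s : S) := h s.1 s.2.1 s.2.2.
pose B t q j (k : 'I_m) (y : 'I_J * 'I_r) : {poly algC} :=
  map_poly (phi t) (relcoef q j (widen_ord (leqnSn m) k, y)).
pose V (s : S) (k : 'I_m) (s' : S) : {poly algC} :=
  (s'.1 == s.1)%:R * - \sum_t \adj Q s.2.2 t * B t s.1 s.2.1 k s'.2.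
apply: (@theta_system _ iota S hS m (\det Q) V detQ _ _ (q, (j, l))) => [s|s].
  exact: ch.
case: s => q1 [j1 l1].
have /filter_forall rel := fun t => functional_relation q1 j1 (proj1 (hphi t)).
apply: filterS rel => z rel; rewrite /hS /=.
(* The terms of order m carry the matrix Q; all others go to the right. *)
have top t : \sum_l ev iota (Q t l) z * psum iota (euler_iter m (h q1 j1 l)) z =
   - \sum_(k < m) \sum_(y : 'I_J * 'I_r) ev iota (B t q1 j1 k y) z
        * psum iota (euler_iter k (h q1 y.1 y.2)) z.
  have := rel t; rewrite -(pair_bigA _ (fun (k : 'I_m.+1) (y : 'I_J * 'I_r) =>
    ev iota (map_poly (phi t) (relcoef q1 j1 (k, y))) z * psum iota (euler_iter k (h q1 y.1 y.2)) z)) /=.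
  rewrite big_ord_recr /= addrC => /eqP; rewrite addr_eq0 => /eqP <-.
  rewrite -(pair_bigA _ (fun (j' : 'I_J) (l' : 'I_r) =>
    ev iota (map_poly (phi t) (relcoef q1 j1 (ord_max, (j', l')))) z
      * psum iota (euler_iter m (h q1 j' l')) z)) /= (bigD1 j1) //= [X in _ = _ + X]big1 ?addr0.
    by apply: eq_bigr => l' _; rewrite relcoef_top eqxx mul1r mxE.
  move=> j' /negPf jj'; rewrite big1 // => l' _.
  rewrite relcoef_top eq_sym jj' mul0r scale0r.
  by rewrite (_ : map_poly _ _ = 0) ?ev0 ?mul0r // /map_poly size_poly0; apply/polyP => i;
    rewrite coef_poly coef0.
transitivity (\sum_t ev iota (\adj Q l1 t) z *
    \sum_l' ev iota (Q t l') z * psum iota (euler_iter m (h q1 j1 l')) z).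
  under [RHS]eq_bigr => t _ do rewrite mulr_sumr.
  rewrite exchange_big /= (bigD1 l1) //= [X in _ = _ + X]big1 ?addr0 => [|l' ll'].
    under eq_bigr => t _ do rewrite mulrA -evM.
    rewrite -mulr_suml -ev_sum; congr (ev _ _ _ * _).
    have := congr1 (fun A : 'M[{poly algC}]_r => A l1 l1) (mul_adj_mx Q).
    by rewrite !mxE eqxx mulr1n => <-.
  under eq_bigr => t _ do rewrite mulrA -evM.
  rewrite -mulr_suml -ev_sum; have := congr1 (fun A : 'M[{poly algC}]_r => A l1 l') (mul_adj_mx Q).
  by rewrite !mxE eq_sym (negPf ll') mulr0n => ->; rewrite ev0 mul0r.
under [LHS]eq_bigr => t _ do rewrite top mulrN mulr_sumr.
rewrite sumrN exchange_big -sumrN; apply: eq_bigr => k _ /=.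
rewrite -(pair_bigA _ (fun (q' : 'I_N) (y : 'I_J * 'I_r) =>
  ev iota (V (q1, (j1, l1)) k (q', y)) z * psum iota (euler_iter k (h q' y.1 y.2)) z)) /=.
rewrite (bigD1 q1) //= [X in _ = _ + X]big1 ?addr0 => [|q' /negPf qq']; last first.
  by rewrite big1 // => y _; rewrite /V /= qq' mul0r ev0 mul0r.
under [in LHS]eq_bigr => t _ do rewrite mulr_sumr.
rewrite exchange_big -sumrN; apply: eq_bigr => y _ /=.
rewrite /V /= eqxx mul1r evN ev_sum mulNr mulr_suml; congr (- _).
by apply: eq_bigr => t _; rewrite evM mulrA.
Qed.

End Descent.

(** * Normal form of Nilsson series and conclusion *)

Lemma common_denominator (s : seq rat) : exists N M : nat, (0 < N)%N /\
  forall x, x \in s -> exists k : nat, x = k%:R / N%:R - M%:R.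
Proof.
elim: s => [|x s [N [M [N0 IH]]]]; first by exists 1%N, 0%N.
pose d := `|denq x|%N; pose a := `|numq x|%N.
have d0 : (0 < d)%N by rewrite absz_gt0 denq_neq0.
have dE : (d%:R : rat) = (denq x)%:~R by rewrite /d -[RHS]/((denq x)%:~R) -{2}(absz_denq x).
exists (N * d)%N, (M + a)%N; split; first by rewrite muln_gt0 N0.
have Nq : (N%:R : rat) != 0 by rewrite pnatr_eq0 -lt0n.
have dq : (d%:R : rat) != 0 by rewrite pnatr_eq0 -lt0n.
move=> y; rewrite inE => /orP[/eqP ->|/IH[k ->]]; last first.
  exists (k * d + a * (N * d))%N.
  rewrite !natrD !natrM; field.
  by rewrite Nq dq.
pose c : int := numq x + (M + a)%:Z * d%:Z.
have c0 : 0 <= c.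
  rewrite /c PoszD mulrDl; have : - (a%:Z) <= numq x by rewrite /a abszE lerNl -normrN; exact: ler_norm.
  have : a%:Z <= a%:Z * d%:Z by rewrite ler_peMr // lez_nat.
  have : 0 <= M%:Z * d%:Z by [].
  lia.
exists (`|c| * N)%N; rewrite !natrM -[X in X * N%:R]/((Posz `|c|)%:~R) gez0_abs //.
rewrite /c rmorphD rmorphM /=.
have -> : (numq x)%:~R = x * d%:R by rewrite dE numqE.
rewrite natrD; field.
by rewrite Nq dq.
Qed.

Section Main.
Variables (R : realType) (iota : {rmorphism algC -> R[i]}).
Local Notation C := (R[i]^o).

(** An injective indexing by (alpha, j, k) turns a finite family of terms
    into a finite set of indices. *)
Lemma nilsson_of_family (P : (nat -> algC) -> Prop) (u : C) (L F : C -> C)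
    (I : finType) (g : I -> rat * nat * nat) (lam : I -> C) (h : I -> nat -> algC) :
  injective g -> (forall i, P (h i)) ->
  (\forall z \near within (slit_plane u) (nbhs (0 : C)), F z =
    \sum_i lam i * cexp (ratr (g i).1.1 * L z : C) * L z ^+ (g i).1.2 * psum iota (h i) z) ->
  nilsson_form iota P u L F.
Proof.
move=> ginj hP hF; pose S := [fset x in [seq g i | i <- index_enum I]]%fset.
pose inv x := [pick i | g i == x].
have invE i : inv (g i) = Some i.
  by rewrite /inv; case: pickP => [i' /eqP /ginj ->|/(_ i)] //; rewrite eqxx.
exists S, (fun al j k => oapp lam 0 (inv (al, j, k))),
  (fun al j k => oapp h (fun=> 0) (inv (al, j, k))); split.
  move=> al j k; rewrite in_fset /= => /mapP[i _ ->]; rewrite invE; exact: hP.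
apply: filterS hF => z ->.
have pS : perm_eq S [seq g i | i <- index_enum I].
  apply: uniq_perm; rewrite ?fset_uniq ?map_inj_uniq ?index_enum_uniq //.
  by move=> x; rewrite in_fset.
rewrite (perm_big _ pS) big_map /=; apply: eq_bigr => i _.
by move: (invE i); case: (g i) => [[al j] k] /= ->.
Qed.

Variables (u : C) (L : C -> C).
Hypotheses (u0 : u != 0) (hL : log_determination u L).
Local Notation FD := (within (slit_plane u) (nbhs (0 : C))).

Lemma cpsum_iter_shift e (a : nat -> C) : geom_bounded a ->
  geom_bounded (iter e (@seq_shift _) a) /\
  \forall z \near (0 : C), cpsum (iter e (@seq_shift _) a) z = z ^+ e * cpsum a z.
Proof.
move=> ca; elim: e => [|e [ce IH]].
  by split=> //; apply: (@filterE _ (nbhs (0 : C))) => z; rewrite expr0 mul1r.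
split; first exact: geom_bounded_shift.
by apply: filterS2 IH (cpsum_shift ce) => z h /= ->; rewrite h exprS mulrA.
Qed.

Lemma iota_iter_shift e (a : nat -> algC) :
  (fun n => iota (iter e (@seq_shift _) a n) : C) = iter e (@seq_shift _) (fun n => iota (a n) : C).
Proof.
elim: e => [//|e IH] /=; rewrite -IH; apply/funext => -[|n] //=.
by rewrite rmorph0.
Qed.

Lemma near_all_seq (T : eqType) (S : seq T) (P : T -> C -> Prop) :
  (forall s, s \in S -> \forall z \near (0 : C), P s z) ->
  \forall z \near (0 : C), forall s, s \in S -> P s z.
Proof.
elim: S => [|s S IH] hP; first exact: (@filterE _ (nbhs (0 : C))).
have h1 := hP s (mem_head _ _).
have h2 : \forall z \near (0 : C), forall s', s' \in S -> P s' z.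
  by apply: IH => s' sS; apply: hP; rewrite inE sS orbT.
apply: filterS2 h1 h2 => z h1 h2 s'; rewrite inE => /orP[/eqP ->//|]; exact: h2.
Qed.

(** An exponent k / N - M is (k mod N) / N - M plus an integer e >= 0,
    and z^e is absorbed by the power series.  The scalars are expressed in a family
    mu independent over the algebraic numbers, and their algebraic coordinates are
    absorbed as well: arithmetic growth is stable under shifts and linear
    combinations. *)
Lemma nilsson_normal_form (F : C -> C) : NGA0 iota u L F ->
  exists (N J M r : nat) (mu : 'I_r -> R[i]) (h : 'I_N -> nat -> 'I_r -> nat -> algC),
  [/\ (0 < N)%N, indep iota mu, forall q j l, arith_growth iota (h q j l),
    forall q j l n, (J <= j)%N -> h q j l n = 0 &
    \forall z \near FD, F z = Phi L J (fun q : 'I_N => q%:R / N%:R - M%:R : C)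
      (fun q j n => \sum_l mu l * iota (h q j l n)) z].
Proof.
move=> [S [lam [f [hf hF]]]].
have [N [M [N0 hNM]]] := common_denominator [seq s.1.1 | s <- S].
have /choice[k hk] : forall s : rat * nat * nat, exists k : nat, s \in S ->
    s.1.1 = k%:R / N%:R - M%:R.
  move=> s; have [sS|nS] := boolP (s \in S); last by exists 0%N.
  by have [k ks] := hNM s.1.1 (map_f _ sS); exists k.
have [r [mu [imu span]]] := indep_spanning iota [seq lam s.1.1 s.1.2 s.2 | s <- S].
have /choice[c hc] : forall s : rat * nat * nat, exists c : 'I_r -> algC, s \in S ->
    lam s.1.1 s.1.2 s.2 = \sum_i iota (c i) * mu i.
  move=> s; have [sS|nS] := boolP (s \in S); last by exists (fun=> 0).
  by have [c cs] := span (lam s.1.1 s.1.2 s.2) (map_f (fun s => lam s.1.1 s.1.2 s.2) sS); exists c.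
pose J := (\max_(s <- S) s.1.2).+1.
pose Q (s : rat * nat * nat) : 'I_N := Ordinal (ltn_pmod (k s) N0).
pose ff (s : rat * nat * nat) : nat -> algC :=
  if s \in S then iter (k s %/ N)%N (@seq_shift _) (f s.1.1 s.1.2 s.2) else fun=> 0.
have agS s : s \in S -> arith_growth iota (f s.1.1 s.1.2 s.2).
  by case: s => [[al j] l]; exact: hf.
have agf s : arith_growth iota (ff s).
  rewrite /ff; case: ifP => [/agS sS|_]; last exact: arith_growth0.
  by elim: (k s %/ N)%N => [//|e IH]; exact: arith_growth_shift.
pose hits (s : rat * nat * nat) (q : 'I_N) (j : nat) : bool := (Q s == q) && (s.1.2 == j).
pose h (q : 'I_N) j (l : 'I_r) : nat -> algC := fun n =>
  \sum_(s <- S) ((hits s q j)%:R * c s l) * ff s n.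
exists N, J, M, r, mu, h; split=> //.
- by move=> q j l; apply: arith_growth_sum => s; exact: arith_growthZ.
- move=> q j l n hj; rewrite /h big1_seq // => s /andP[_ sS].
  rewrite /hits [s.1.2 == j]ltn_eqF ?andbF ?mul0r //.
  by apply: leq_trans hj; rewrite ltnS; exact: (@leq_bigmax_seq _ _ xpredT (fun s => s.1.2)).
have GE q j : (fun n => \sum_l mu l * iota (h q j l n)) =
    (fun n => \sum_(s <- S) ((hits s q j)%:R * lam s.1.1 s.1.2 s.2) * iota (ff s n)).
  apply/funext => n; rewrite /h.
  under eq_bigr => l _ do rewrite rmorph_sum mulr_sumr.
  rewrite exchange_big; apply: eq_big_seq => s sS.
  rewrite (hc s sS) mulr_sumr mulr_suml; apply: eq_bigr => l _.
  by rewrite !rmorphM rmorph_nat; ring.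
have /filter_forall nG : forall q : 'I_N, \forall z \near FD, forall j : 'I_J,
    cpsum (fun n => \sum_l mu l * iota (h q j l n) : C) z =
    \sum_(s <- S) ((hits s q j)%:R * lam s.1.1 s.1.2 s.2) * psum iota (ff s) z.
  move=> q; apply: filter_forall => j; apply: near_FD0; rewrite GE.
  have cs s : geom_bounded (fun n => iota (ff s n) : C) by exact: arith_growth_geom_bounded.
  have h1 := near_all_seq (S := S) (fun s _ => cpsumZ ((hits s q j)%:R * lam s.1.1 s.1.2 s.2) (cs s)).
  have h2 := cpsum_sum S (fun s => geom_boundedZ ((hits s q j)%:R * lam s.1.1 s.1.2 s.2) (cs s)).
  by apply: filterS2 h1 h2 => z h1 ->; apply: eq_big_seq => s sS; rewrite h1.
have nf : \forall z \near FD, forall s, s \in S ->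
    psum iota (ff s) z = z ^+ (k s %/ N)%N * psum iota (f s.1.1 s.1.2 s.2) z.
  apply: near_FD0; apply: near_all_seq => s sS.
  have [_] := cpsum_iter_shift (k s %/ N)%N (arith_growth_geom_bounded (agS s sS)).
  by apply: filterS => z hz; rewrite !psumE /ff sS iota_iter_shift.
apply: filterS3 (filterI nG nf) hF (near_slit u) => z [{}nG {}nf] -> zu.
have [_ hE] := hL; have z0 := slit_neq0 zu.
rewrite /Phi.
transitivity (\sum_(s <- S) \sum_(q < N) \sum_(j < J) cexp ((q%:R / N%:R - M%:R) * L z : C)
   * L z ^+ j * ((hits s q j)%:R * lam s.1.1 s.1.2 s.2 * psum iota (ff s) z)); last first.
  rewrite exchange_big; apply: eq_bigr => q _.
  rewrite exchange_big; apply: eq_bigr => j _.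
  by rewrite nG mulr_sumr.
apply: eq_big_seq => s sS.
rewrite [LHS](_ : _ = lam s.1.1 s.1.2 s.2 * cexp (ratr s.1.1 * L z : C) * L z ^+ s.1.2
  * psum iota (f s.1.1 s.1.2 s.2) z); last by case: (s) => [[? ?] ?].
have jJ : (s.1.2 < J)%N by rewrite ltnS; exact: (@leq_bigmax_seq _ _ xpredT (fun s => s.1.2)).
rewrite (bigD1 (Q s)) //= [X in _ = _ + X]big1 ?addr0 => [|q /negPf qs]; last first.
  by rewrite big1 // => j _; rewrite /hits eq_sym qs !mul0r mulr0.
rewrite (bigD1 (Ordinal jJ)) //= [X in _ = _ + X]big1 ?addr0 => [|j]; last first.
  by rewrite -val_eqE /= => /negPf js; rewrite /hits eqxx eq_sym js !mul0r mulr0.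
rewrite /hits !eqxx mul1r nf //.
have -> : cexp (ratr s.1.1 * L z : C) = z ^+ (k s %/ N)%N * cexp (((k s %% N)%N%:R / N%:R - M%:R) * L z : C).
  rewrite -{2}(hE z zu) -cexp_natM -cexpD; congr cexp; rewrite (hk s sS).
  rewrite rmorphB fmorph_div !rmorph_nat {1}(divn_eq (k s) N) natrD natrM.
  have Nq : (N%:R : R[i]) != 0 by rewrite pnatr_eq0 -lt0n.
  by move: (L z) => w; field.
by move: (cexp _) (psum _ _ _) (L z ^+ _) => a b d; ring.
Qed.

Lemma holonomic_NGA_Gfunctions (F : C -> C) :
  NGA0 iota u L F -> holonomic (slit_plane u) F -> nilsson_form iota (Gfunction iota) u L F.
Proof.
move=> /nilsson_normal_form[N [J [M [r [mu [h [N0 imu agh h0 FG]]]]]]].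
move=> /(ode_poly (@slit_neq0 _ u))[m [p [pm0 hode]]].
have ode : \forall z \near FD, \sum_(i < m.+1) (p i).[z] * derive1n i F z = 0.
  apply: filterS hode => z [_ hz]; rewrite -[RHS]hz; apply: eq_bigr => i _.
  by rewrite /ev map_poly_id.
have S0 : forall z : C, [set z | z <> 0] z -> z != 0 by move=> z /eqP.
have Gh q (j : 'I_J) l : Gfunction iota (h q j l).
  split; first exact: agh.
  apply: (diffmod_ode (@punctured_open R) S0).
  exact: (descent_diffmod u0 hL imu (fun q j l => arith_growth_geom_bounded (agh q j l)) h0 pm0 FG ode).
apply: (@nilsson_of_family _ u L F ('I_N * ('I_J * 'I_r))%type
  (fun x => (x.1%:R / N%:R - M%:R : rat, x.2.1 : nat, x.2.2 : nat))
  (fun x => mu x.2.2) (fun x => h x.1 x.2.1 x.2.2)).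
- have Nq : (N%:R : rat)^-1 != 0 by rewrite invr_eq0 pnatr_eq0 -lt0n.
  move=> [q [j l]] [q' [j' l']] [] /addIr /(mulIf Nq) /eqP.
  by rewrite eqr_nat => /eqP /val_inj -> /val_inj -> /val_inj ->.
- by move=> x; exact: Gh.
have /filter_forall nG : forall q : 'I_N, \forall z \near FD, forall j : 'I_J,
    cpsum (fun n => \sum_l mu l * iota (h q j l n) : C) z =
    \sum_l mu l * psum iota (h q j l) z.
  move=> q; apply: filter_forall => j; apply: near_FD0.
  have ch l := arith_growth_geom_bounded (agh q j l).
  have /filter_forall h1 := fun l => cpsumZ (mu l) (ch l).
  have h2 := cpsum_sum (index_enum 'I_r) (fun l => geom_boundedZ (mu l) (ch l)).
  by apply: filterS2 h1 h2 => z h1 ->; apply: eq_bigr => l _; rewrite h1.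
apply: filterS2 nG FG => z nG ->; rewrite /Phi.
rewrite -(pair_bigA _ (fun (q : 'I_N) (y : 'I_J * 'I_r) =>
  mu y.2 * cexp (ratr (q%:R / N%:R - M%:R) * L z : C) * L z ^+ y.1 * psum iota (h q y.1 y.2) z)) /=.
apply: eq_bigr => q _.
rewrite -(pair_bigA _ (fun (j : 'I_J) (l : 'I_r) =>
  mu l * cexp (ratr (q%:R / N%:R - M%:R) * L z : C) * L z ^+ j * psum iota (h q j l) z)) /=.
apply: eq_bigr => j _; rewrite nG mulr_sumr; apply: eq_bigr => l _.
rewrite rmorphB fmorph_div !rmorph_nat.
by move: (cexp _) (psum _ _ _) => a b; ring.
Qed.

End Main.

Theorem proposition1 (R : realType) (iota : {rmorphism algC -> R[i]})
    (u : R[i]^o) (L : R[i]^o -> R[i]^o)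
    (hu : u != 0) (hL : log_determination u L) (F : R[i]^o -> R[i]^o) :
  (NGA0 iota u L F /\ holonomic (slit_plane u) F) <->
  nilsson_form iota (Gfunction iota) u L F.
Proof.
split; first by case; exact: holonomic_NGA_Gfunctions.
exact: nilsson_Gfunction_holonomic.
Qed.
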